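(* Consider the fairness-resolution MDP described in the context with all correlation sets of size one ($m=1$). Then (i) for any $\epsilon,\delta>0$, the true parameter vector can be approximated to within $\epsilon$ in $\ell_\infty$-norm with probability at least $1-\delta$, in at most $O\big(\frac{B^2k}{\epsilon^2}\log\frac{k}{\delta}\big)$ time steps and by exploring at most $k+1$ specific states of $\mathcal{S}$; and (ii) given a parameter vector, there is an algorithm running in time polynomial in $k$ that finds a state $s'\in\mathcal{S}$ with $g(s')\le 2\min_{s\in\mathcal{S}}g(s)$.
   Context: Model: $\mathcal{G}=(V,E)$ undirected graph on $V=\{v_1,\dots,v_k\}$, $N(i)$ neighbour indices of $v_i$. States $\mathcal{S}=\{s\in\{0,1\}^k:\{v_i:s(i)=1\}$ independent in $\mathcal{G}\}$ ($s(i)=1$: criterion fixed). Actions $\{0,\dots,k\}$: $0$ keeps the state; $i\neq0$ sets $s(i)=1$ and $s(j)=0$ for $j\in N(i)$; fixing costs $c_i\ge 0$. With correlation sets of size one, the parameter vector consists of $2k$ numbers $\gamma_i^0,\gamma_i^1\ge 0$ ($i\in[k]$), and the mean complaint loss of criterion $i$ at state $s$ is $\mu_i^s=\gamma_i^{s(i)}$. While in state $s$, at each time step the algorithm observes for each $i$ a loss $\ell_i\in[0,B]$ drawn independently from a distribution with mean $\mu_i^s$. $g(s)=\sum_{i=1}^k\mu_i^s$ is the expected per-step loss of staying in $s$.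
   Formalization: The time bound is proved as O((B²k/ε²)(1 + log(k/δ))) for 0 < δ < 1, since the literal bound fails for k = 1 as δ → 1 and is negative for δ > k; for k ≥ 2 the two agree up to a constant. Exploration starts from the state with no criterion fixed. *)

(* Defs.v *)
From HB Require Import structures.
From mathcomp Require Import all_boot all_order all_algebra.
From mathcomp Require Import all_classical all_reals all_analysis.

Set Implicit Arguments.
Unset Strict Implicit.
Unset Printing Implicit Defensive.

Import Order.TTheory GRing.Theory Num.Theory.
Import numFieldNormedType.Exports.

Local Open Scope classical_set_scope.
Local Open Scope ring_scope.

Definition simple_graph (k : nat) (e : rel 'I_k) : Prop :=
  symmetric e /\ irreflexive e.

(** A (candidate) state: s(i) = true means criterion i is fixed. *)
Notation state k := {ffun 'I_k -> bool}.

(** s is in the state space S iff {v_i : s(i) = 1} is independent in G. *)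
Definition independent (k : nat) (e : rel 'I_k) (s : state k) : bool :=
  [forall i, forall j, e i j ==> ~~ (s i && s j)].

(** Actions: [None] is action 0 (keep the state); [Some i] fixes criterion i:
    sets s(i)=1 and s(j)=0 for every neighbour j of i. *)
Definition step (k : nat) (e : rel 'I_k) (s : state k) (a : option 'I_k)
  : state k :=
  match a with
  | None => s
  | Some i => [ffun j => if j == i then true else if e i j then false else s j]
  end.

Definition state0 (k : nat) : state k := [ffun => false].

(** Parameter vector: [gam i false] = gamma_i^0, [gam i true] = gamma_i^1;
    mean loss of criterion i in state s is mu_i^s = gam i (s i). *)
Definition mu (R : Type) (k : nat) (gam : 'I_k -> bool -> R) (s : state k)
  (i : 'I_k) : R := gam i (s i).

(** g(s) = sum_i mu_i^s : expected per-step loss of staying in s. *)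
Definition g (R : realType) (k : nat) (gam : 'I_k -> bool -> R) (s : state k)
  : R := \sum_(i < k) mu gam s i.

(** Interaction of an (adaptive) exploration policy with the MDP.
    [obs t s] is the loss vector observed at time t when in state s.
    At time t the agent is in state s_t, observes [obs t s_t], then chooses
    an action from the whole history of observations (times 0..t);
    [run n] = (s_n, observations at times 0..n-1). *)
Fixpoint run (R : Type) (k : nat) (e : rel 'I_k)
  (pol : seq ('I_k -> R) -> option 'I_k) (obs : nat -> state k -> 'I_k -> R)
  (n : nat) : state k * seq ('I_k -> R) :=
  match n with
  | 0 => (state0 k, [::])
  | n'.+1 =>
      let: (s, h) := run e pol obs n' in
      let h' := rcons h (obs n' s) in
      (step e s (pol h'), h')
  end.

Definition mutually_independent (d : measure_display) (T : measurableType d)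
  (R : realType) (P : probability T R) (J : finType)
  (X : J -> {RV P >-> R}) : Prop :=
  forall A : J -> set R, (forall j, measurable (A j)) ->
    P (\bigcap_(j in [set: J]) (X j @^-1` A j)) =
    (\prod_(j : J) P (X j @^-1` A j))%E.

(** The samples: [Y (t, i, s)] is the loss of criterion i that would be
    observed at time t if the process were in state s at time t.  All of
    them are mutually independent, so the observed loss at time t,
    [Y (t, i, s_t)], is a fresh independent draw from the loss distribution
    of criterion i in the current state s_t. *)
Definition observations (d : measure_display) (T : measurableType d)
  (R : realType) (P : probability T R) (k Tn : nat)
  (Y : 'I_Tn * 'I_k * state k -> {RV P >-> R}) (w : T)
  : nat -> state k -> 'I_k -> R :=
  fun t s i => if (insub t : option 'I_Tn) is Some t' then Y (t', i, s) w
               else 0.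

(** * A real-RAM model of computation (for "polynomial time").
    Integer registers (unit-cost addition / truncated subtraction /
    comparison, indirect addressing) and real registers (unit-cost
    +, -, *, comparison, indirect addressing). *)
Inductive instr : Type :=
| NSet of nat & nat          (* N[a] := c *)
| NAdd of nat & nat & nat    (* N[a] := N[b] + N[c] *)
| NSub of nat & nat & nat    (* N[a] := N[b] - N[c] (truncated) *)
| NLoad of nat & nat         (* N[a] := N[N[b]] *)
| NStore of nat & nat        (* N[N[a]] := N[b] *)
| RZero of nat               (* M[a] := 0 *)
| ROne of nat                (* M[a] := 1 *)
| RAdd of nat & nat & nat    (* M[a] := M[b] + M[c] *)
| RSub of nat & nat & nat    (* M[a] := M[b] - M[c] *)
| RMul of nat & nat & nat    (* M[a] := M[b] * M[c] *)
| RLoad of nat & nat         (* M[a] := M[N[b]] *)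
| RStore of nat & nat        (* M[N[a]] := M[b] *)
| JNLe of nat & nat & nat    (* if N[a] <= N[b] then goto l *)
| JRLe of nat & nat & nat    (* if M[a] <= M[b] then goto l *)
| Halt.

Record config (R : Type) := Config {
  pc : nat; nmem : nat -> nat; rmem : nat -> R }.

Definition upd (A : Type) (f : nat -> A) (a : nat) (v : A) : nat -> A :=
  fun n => if n == a then v else f n.

Definition ram_step (R : realType) (prog : seq instr) (c : config R)
  : config R :=
  let: Config p N M := c in
  match nth Halt prog p with
  | NSet a v => Config p.+1 (upd N a v) M
  | NAdd a b c' => Config p.+1 (upd N a (N b + N c')%N) M
  | NSub a b c' => Config p.+1 (upd N a (N b - N c')%N) M
  | NLoad a b => Config p.+1 (upd N a (N (N b))) M
  | NStore a b => Config p.+1 (upd N (N a) (N b)) M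
  | RZero a => Config p.+1 N (upd M a 0)
  | ROne a => Config p.+1 N (upd M a 1)
  | RAdd a b c' => Config p.+1 N (upd M a (M b + M c'))
  | RSub a b c' => Config p.+1 N (upd M a (M b - M c'))
  | RMul a b c' => Config p.+1 N (upd M a (M b * M c'))
  | RLoad a b => Config p.+1 N (upd M a (M (N b)))
  | RStore a b => Config p.+1 N (upd M (N a) (M b))
  | JNLe a b l => Config (if (N a <= N b)%N then l else p.+1) N M
  | JRLe a b l => Config (if M a <= M b then l else p.+1) N M
  | Halt => c
  end.

(** [ram_exec prog n c] = Some c' iff the program halts (reaches a [Halt]
    instruction, or jumps outside the program) after at most n steps. *)
Fixpoint ram_exec (R : realType) (prog : seq instr) (fuel : nat)
  (c : config R) : option (config R) :=
  match nth Halt prog (pc c) with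
  | Halt => Some c
  | _ => match fuel with
         | 0 => None
         | f.+1 => ram_exec prog f (ram_step prog c)
         end
  end.

(** Input encoding: N[0] = k, N[1 + u*k + v] = [e u v] (adjacency matrix),
    M[i] = gamma_i^0, M[k + i] = gamma_i^1; everything else 0. *)
Definition ram_input (R : realType) (k : nat) (e : rel 'I_k)
  (gam : 'I_k -> bool -> R) : config R :=
  Config 0
    (fun n => if n == 0%N then k
              else if (n.-1 < k * k)%N then
                match (insub (n.-1 %/ k)%N : option 'I_k),
                      (insub (n.-1 %% k)%N : option 'I_k) with
                | Some u, Some v => nat_of_bool (e u v)
                | _, _ => 0%N
                end
              else 0%N)
    (fun n => if (insub n : option 'I_k) is Some i then gam i false
              else if (insub (n - k)%N : option 'I_k) is Some i then
                     (if (k <= n)%N then gam i true else 0)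
              else 0).

Definition ram_output (R : realType) (k : nat) (c : config R) : state k :=
  [ffun i : 'I_k => nmem c (1 + k * k + i)%N != 0%N].

(* Main.v *)
(** (i) Staying [n] steps in the initial state and then [n] steps after fixing
    each criterion in turn visits [k + 1] fixed states; the [2 k] parameters are
    estimated by sample means. The exploration is deterministic, so the samples
    are independent, and a Chernoff bound with a union bound gives the rate.

    (ii) With [w_i = max(gamma_i^0 - gamma_i^1, 0)], minimising [g] amounts to a
    minimum-weight vertex cover, up to a nonnegative constant. The local-ratio
    algorithm lowers the weights of both ends of every edge by the smaller one
    and fixes the criteria whose residual weight is positive: the total payment
    is at most twice what any vertex cover pays. *)

Require Import Defs.
From HB Require Import structures.
From mathcomp Require Import all_boot all_order all_algebra.
From mathcomp Require Import all_classical all_reals all_analysis.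
From mathcomp Require Import measurable_realfun zify ring lra.
Import Order.TTheory GRing.Theory Num.Theory.
Import numFieldNormedType.Exports.
Local Open Scope classical_set_scope.
Local Open Scope ring_scope.

Set Implicit Arguments.
Unset Strict Implicit.
Unset Printing Implicit Defensive.

(** * Learning the parameters *)

(** Independence is given as a product rule for preimages of measurable sets, so the Chernoff bound
    is built from probabilities of rectangles, and no expectation of a product is factorised.
    Criterion [i] is sampled right after its own fixing because a later action on a neighbour may
    unfix it; the unfixed means of all criteria come from one common phase. The exponential moment
    bound asks for [eps <= B]; when [B <= eps], the estimate [0] is accurate enough.

    For the second claim the combinatorics is short; the obstacle is an explicit jump program with a
    step bound. It is written in a small structured language, compiled to absolute jumps, and
    verified with rules that carry the number of steps. The input and output cells spread with [k],
    so the code takes the base address [b] of its working registers as a parameter. *)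

Lemma expR_le_quadratic (R : realType) (x : R) :
  x <= 2^-1 -> expR x <= 1 + x + 2 * x ^+ 2.
Proof.
move=> hx; have h1 : 1 - x <= expR (- x) by exact: expR_ge1Dx.
have h2 : expR x * expR (- x) = 1 by rewrite -expRD subrr expR0.
have h3 := expR_gt0 x.
have h4 : expR x * (1 - x) <= 1 by rewrite -[leRHS]h2 ler_pM2l.
(* The product [(1 + x + 2 x^2) (1 - x)] exceeds [1] by [x^2 (1 - 2 x)], which is nonnegative for
   [x <= 1/2]. *)
rewrite -(@ler_pM2r _ (1 - x)); last by lra.
apply: le_trans h4 _; rewrite expr2; nra.
Qed.

(** Monotonicity and the union bound in one; it serves for the mesh cells, for the two signs of a
    deviation and for the [2 k] parameters. *)
Lemma measure_le_sum (d : measure_display) (T : measurableType d)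
    (R : realType) (mu : {measure set T -> \bar R}) (I : finType)
    (A : set T) (F : I -> set T) (a : I -> R) :
  measurable A -> (forall i, measurable (F i)) ->
  (forall w, A w -> exists i, F i w) ->
  (forall i, (mu (F i) <= (a i)%:E)%E) -> (mu A <= (\sum_i a i)%:E)%E.
Proof.
move=> mA mF AF muF.
have mU s : measurable (\big[setU/set0]_(i <- s) F i).
  exact: bigsetU_measurable.
apply: (@le_trans _ _ (mu (\big[setU/set0]_i F i))).
  apply: le_measure; rewrite ?inE//.
  move=> w /AF[i Fi]; rewrite -bigcup_seq; exists i => //=.
  exact: mem_index_enum.
elim: (index_enum I) => [|i s ih]; first by rewrite !big_nil measure0.
rewrite !big_cons EFinD; apply: le_trans (measureU2 _ (mF i) (mU s)) _.
by apply: leeD; [exact: muF | exact: ih].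
Qed.


Lemma prod_EFin (R : realType) (I : finType) (F : I -> R) :
  (\prod_i (F i)%:E = (\prod_i F i)%:E)%E.
Proof. by rewrite (big_morph EFin (@EFinM R) erefl). Qed.

(** The complement of [[0, B]] is null, so integrals over the line restrict to the interval, where
    the identity is bounded and hence integrable. *)
Lemma mean_over_support (R : realType) (D : probability R R) (B m : R) :
  D `[0, B]%classic = 1%E -> (\int[D]_x x%:E = m%:E)%E ->
  [/\ D.-integrable `[0, B] (EFin : R -> \bar R),
      (\int[D]_(x in `[0%R, B]) x%:E = m%:E)%E & 0 <= m <= B].
Proof.
move=> D1 hm; have mI : measurable (`[0%R, B]%classic : set R) by exact: measurable_itv.
have DC : D (~` `[0, B]%classic) = 0%E.
  by rewrite probability_setC// D1 subee.
have iI : D.-integrable `[0, B] (EFin : R -> \bar R).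
  apply: (@le_integrable _ _ _ D _ mI _ (EFin \o cst B)) => //.
  - move=> x /=; rewrite in_itv/= => /andP[x0 xB].
    by rewrite lee_fin !ger0_norm// (le_trans x0).
  - exact: finite_measure_integrable_cst.
have iT : D.-integrable setT (EFin : R -> \bar R).
  apply/integrableP; split; first by exact: EFin_measurable.
  rewrite (ge0_negligible_integral (N := ~` `[0, B]%classic))//.
  - by rewrite setTD setCK; case/integrableP: iI.
  - exact: measurableC.
  - by apply: measurableT_comp => //; exact: EFin_measurable.
have e : (\int[D]_(x in `[0%R, B]) x%:E = m%:E)%E.
  rewrite -hm [RHS](negligible_integral (N := ~` `[0, B]%classic))//.
  - by rewrite setTD setCK.
  - exact: measurableC.
split=> //; apply/andP; split; rewrite -lee_fin -e.
  by apply: integral_ge0 => x /=; rewrite in_itv/= lee_fin => /andP[].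
have -> : B%:E = (\int[D]_(x in `[0%R, B]) (cst B%:E) x)%E.
  by rewrite integral_cst// [X in (_ * X)%E](_ : _ = 1%E) ?mule1.
apply: le_integral => //; first exact: finite_measure_integrable_cst.
by move=> x; rewrite inE/= in_itv/= lee_fin => /andP[].
Qed.

(** A weak form of Hoeffding's lemma. In the quadratic bound for the exponential the square is
    replaced by [B^2 c^2], which leaves the affine function [al + c x]; its integral depends on the
    mean alone, and [1 + y <= exp y] finishes. *)
Lemma mgf_bounded (R : realType) (D : probability R R) (B m c : R) :
  D `[0, B]%classic = 1%E -> (\int[D]_x x%:E = m%:E)%E -> `|c| * B <= 2^-1 ->
  (\int[D]_(x in `[0%R, B]) (expR (c * (x - m)))%:E
     <= (expR (2 * B ^+ 2 * c ^+ 2))%:E)%E.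
Proof.
move=> D1 hm hc; have [iI e /andP[m0 mB]] := mean_over_support D1 hm.
have mI : measurable (`[0%R, B]%classic : set R) by exact: measurable_itv.
pose al := 1 - c * m + 2 * B ^+ 2 * c ^+ 2.
have icst k : D.-integrable `[0, B] (EFin \o cst k).
  exact: finite_measure_integrable_cst.
have icx : D.-integrable `[0, B] (fun x : R => c%:E * x%:E)%E.
  exact: integrableZl.
apply: (@le_trans _ _ (\int[D]_(x in `[0%R, B]) ((EFin \o cst al) x + c%:E * x%:E)%E)%E).
  apply: ge0_le_integral => //.
  - apply/measurable_EFinP; apply: measurableT_comp => //.
    by apply: measurable_funM => //; exact: measurable_funB.
  - by apply: emeasurable_funD; [exact: (measurable_int D)|exact: (measurable_int D)].
  - move=> x /=; rewrite in_itv/= => /andP[x0 xB]; rewrite -EFinM -EFinD lee_fin.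
    have ab : `|c * (x - m)| <= `|c| * B.
      rewrite normrM ler_wpM2l// ler_norml; apply/andP; split; lra.
    have ab2 : (c * (x - m)) ^+ 2 <= B ^+ 2 * c ^+ 2.
      rewrite -[leLHS]real_normK ?num_real// -[c ^+ 2]real_normK ?num_real//.
      rewrite -exprMn [B * _]mulrC; apply: lerXn2r => //; rewrite nnegrE mulr_ge0//.
      exact: le_trans xB.
    have hx : c * (x - m) <= 2^-1.
      by apply: le_trans (ler_norm _) _; apply: le_trans ab hc.
    apply: le_trans (expR_le_quadratic hx) _; rewrite /al; nra.
rewrite integralD//.
have -> : (\int[D]_(x in `[0%R, B]) (EFin \o cst al) x = al%:E)%E.
  rewrite -[LHS]/(\int[D]_(x in `[0%R, B]) (cst al%:E) x)%E integral_cst//.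
  by rewrite [X in (_ * X)%E](_ : _ = 1%E) ?mule1.
rewrite integralZl// e -EFinM -EFinD lee_fin.
have -> : al + c * m = 1 + 2 * B ^+ 2 * c ^+ 2 by rewrite /al; ring.
exact: expR_ge1Dx.
Qed.

(* Discretising the range into cells of width [h] makes the joint law a finite
   sum of products, which distributes; [chernoff] then lets [h] tend to 0. *)
Lemma chernoff_mesh (d : measure_display) (T : measurableType d)
    (R : realType) (P : probability T R) (J : finType) (X : J -> {RV P >-> R})
    (D : J -> probability R R) (B t h : R) (c m M : J -> R) :
  0 < h -> mutually_independent X ->
  (forall j A, measurable A -> distribution P (X j) A = D j A) ->
  (forall j, D j `[0, B]%classic = 1%E) ->
  (forall j, (\int[D j]_(x in `[0%R, B]) (expR (c j * (x - m j)))%:E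
     <= (M j)%:E)%E) ->
  (P [set w | t <= \sum_j c j * (X j w - m j)]%R <=
     (expR (\sum_j `|c j| * h - t) * \prod_j M j)%:E)%E.
Proof.
move=> h0 indX distX D1 hM.
set S := `[0, B]%classic in D1 hM *.
have mS : measurable (S : set R) by exact: measurable_itv.
set bad := [set w | _].
have mbad : measurable bad.
  rewrite -[bad]setTI /bad; apply: measurable_fun_le => //.
  apply: measurable_sum => j; apply: measurable_funM => //.
  exact: measurable_funB.
(* The successor provides a cell for the right end [B], since the cells are half-open. *)
pose K := (Num.truncn (B / h)).+1.
pose cell (v : 'I_K) : set R := S `&` `[v%:R * h, v.+1%:R * h[%classic.
have mcell v : measurable (cell v) by apply: measurableI => //; exact: measurable_itv.
have cellS v : cell v `<=` S by move=> x [].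
have cell_trunc v x : cell v x -> Num.truncn (x / h) = v.
  move=> -[_ /=]; rewrite in_itv/= => /andP[h1 h2]; apply: truncn_def.
  by rewrite ler_pdivlMr// h1 ltr_pdivrMr.
have cell_cover x : S x -> exists v, cell v x.
  move=> Sx; have := Sx; rewrite /S/= in_itv/= => /andP[x0 xB].
  have lt : (Num.truncn (x / h) < K)%N.
    by rewrite ltnS; apply: le_truncn; rewrite ler_pM2r ?invr_gt0.
  exists (Ordinal lt); split=> //=; rewrite in_itv/= -ler_pdivlMr// -ltr_pdivrMr//.
  by apply: truncn_itv; rewrite divr_ge0// ltW.
have cell_diam v x y : cell v x -> cell v y -> `|x - y| <= h.
  move=> -[_ /=]; rewrite in_itv/= => /andP[x1 x2].
  move=> -[_ /=]; rewrite in_itv/= => /andP[y1 y2].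
  move: x2 y2; rewrite -natr1 mulrDl mul1r => x2 y2.
  by rewrite ler_norml; apply/andP; split; lra.
have cell_triv : trivIset [set: 'I_K] cell.
  by move=> v v' _ _ [x [/cell_trunc e1 /cell_trunc e2]]; apply: val_inj; rewrite /= -e1.
pose f j (x : R) := (expR (c j * (x - m j)))%:E : \bar R.
have f0 j x : (0 <= f j x)%E by rewrite lee_fin expR_ge0.
have mf j (A : set R) : measurable_fun A (f j).
  apply/measurable_EFinP; apply: measurableT_comp => //.
  by apply: measurable_funM => //; exact: measurable_funB.
pose a j v := fine (\int[D j]_(x in cell v) f j x)%E.
have a0 j v : 0 <= a j v by rewrite fine_ge0// integral_ge0.
have aE j v : (a j v)%:E = (\int[D j]_(x in cell v) f j x)%E.
  rewrite fineK// ge0_fin_numE; last by rewrite integral_ge0.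
  apply: le_lt_trans (ltry (M j)); apply: le_trans (hM j).
  exact: ge0_subset_integral.
have a_sum j : \sum_v a j v <= M j.
  rewrite -lee_fin -sumEFin; apply: le_trans (hM j).
  under eq_bigr do rewrite aE.
  rewrite -(@ge0_integral_bigsetU _ _ _ (D j) _ cell (f j))//.
  - apply: ge0_subset_integral => //; first exact: bigsetU_measurable.
    by rewrite -bigcup_seq => x [v _ /cellS].
  - exact: index_enum_uniq.
  - exact: sub_trivIset cell_triv.
pose A := \bigcap_(j in [set: J]) (X j @^-1` S).
pose E (v : {ffun J -> 'I_K}) := \bigcap_(j in [set: J]) (X j @^-1` cell (v j)).
have mXj j (C : set R) : measurable C -> measurable (X j @^-1` C).
  by move=> mC; rewrite -[_ @^-1` _]setTI; exact: measurable_funPT.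
have mA : measurable A.
  by apply: fin_bigcap_measurable => // j _; exact: mXj.
have mE v : measurable (E v).
  by apply: fin_bigcap_measurable => // j _; exact: mXj.
have PA : P A = 1%E.
  rewrite /A (indX (fun=> S))// big1// => j _.
  by rewrite -[LHS]/(distribution P (X j) S) distX.
have PE v : P (E v) = (\prod_j fine (D j (cell (v j))))%:E.
  rewrite /E (indX (fun j => cell (v j)))// -prod_EFin; apply: eq_bigr => j _.
  by rewrite fineK ?fin_num_measure// -distX.
apply: (@le_trans _ _ (P (bad `&` A) + P (~` A))%E).
  apply: (@le_trans _ _ (P ((bad `&` A) `|` ~` A))).
    apply: le_measure; rewrite ?inE//.
    - by apply: measurableU; [exact: measurableI|exact: measurableC].
    - by move=> w bw; have [Aw|nAw] := pselect (A w); [left|right].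
  by apply: measureU2; [exact: measurableI|exact: measurableC].
rewrite probability_setC// PA subee// adde0.
pose q (v : {ffun J -> 'I_K}) := expR (\sum_j `|c j| * h - t) * \prod_j a j (v j).
apply: (@le_trans _ _ (\sum_v q v)%:E).
  apply: (@measure_le_sum _ _ _ P _ (bad `&` A) (fun v => bad `&` E v) q).
  - exact: measurableI.
  - by move=> v; exact: measurableI.
  - move=> w [bw Aw].
    have /choice[v hv] : forall j, exists v, cell v (X j w).
      by move=> j; apply: cell_cover; exact: Aw.
    by exists [ffun j => v j]; split=> // j _; rewrite /= ffunE.
  (* In a nonempty piece one bad outcome [w] is kept as a reference: each [X j w] is within [h] of
     every point of its cell, so the exponential at [w] times the cell's mass is at most the cell
     integral, up to a factor [exp (|c j| h)]. *)
  - move=> v; have [->|/set0P[w [bw Ew]]] := eqVneq (bad `&` E v) set0.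
      by rewrite measure0 lee_fin mulr_ge0 ?expR_ge0// prodr_ge0.
    apply: (@le_trans _ _ (P (E v))).
      by apply: le_measure; rewrite ?inE//; exact: measurableI.
    rewrite PE lee_fin.
    have step j : expR (c j * (X j w - m j) - `|c j| * h) *
        fine (D j (cell (v j))) <= a j (v j).
      rewrite -lee_fin aE EFinM fineK ?fin_num_measure//.
      rewrite -(@integral_cst _ _ _ (D j))//; apply: ge0_le_integral => //.
      - by move=> x _; rewrite lee_fin expR_ge0.
      - move=> x cx; rewrite lee_fin ler_expR.
        have := cell_diam _ _ _ (Ew j I) cx => hd.
        have : c j * (X j w - x) <= `|c j| * h.
          apply: le_trans (ler_norm _) _; rewrite normrM.
          by apply: ler_wpM2l.
        lra.
    rewrite /q; apply: (@le_trans _ _ (expR (\sum_j `|c j| * h - t) *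
      \prod_j (expR (c j * (X j w - m j) - `|c j| * h) * fine (D j (cell (v j)))))).
      rewrite big_split/= mulrA -expR_sum -expRD ler_peMl//.
        by apply: prodr_ge0 => j _; exact: fine_ge0.
      rewrite -expR0 ler_expR sumrB; move: bw; rewrite /bad/= => bw; lra.
    apply: ler_wpM2l; first exact: expR_ge0.
    apply: ler_prod => j _; rewrite step andbT mulr_ge0 ?expR_ge0//.
    exact: fine_ge0.
rewrite lee_fin /q -big_distrr/= -(bigA_distr_bigA (fun j v => a j v)).
apply: ler_wpM2l; first exact: expR_ge0.
by apply: ler_prod => j _; rewrite a_sum andbT; apply: sumr_ge0.
Qed.

Lemma chernoff (d : measure_display) (T : measurableType d)
    (R : realType) (P : probability T R) (J : finType) (X : J -> {RV P >-> R})
    (D : J -> probability R R) (B t : R) (c m : J -> R) :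
  mutually_independent X ->
  (forall j A, measurable A -> distribution P (X j) A = D j A) ->
  (forall j, D j `[0, B]%classic = 1%E) ->
  (forall j, (\int[D j]_x x%:E = (m j)%:E)%E) ->
  (forall j, `|c j| * B <= 2^-1) ->
  (P [set w | t <= \sum_j c j * (X j w - m j)]%R <=
     (expR (2 * B ^+ 2 * (\sum_j c j ^+ 2) - t))%:E)%E.
Proof.
move=> indX distX D1 Dm hc; set bad := [set w | _].
set Q := 2 * B ^+ 2 * _ - t.
have mesh h : 0 < h -> (P bad <= (expR ((\sum_j `|c j|) * h + Q))%:E)%E.
  move=> h0.
  have := chernoff_mesh t h0 indX distX D1 (fun j => mgf_bounded (D1 j) (Dm j) (hc j)).
  move=> /le_trans; apply; rewrite lee_fin -expR_sum -expRD ler_expR.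
  by rewrite -mulr_sumr -mulr_suml /Q; lra.
have Pfin : P bad \is a fin_num.
  rewrite ge0_fin_numE//; apply: le_lt_trans (ltry _); exact: (mesh 1).
rewrite -(fineK Pfin) in mesh *; move: (fine (P bad)) mesh => p mesh.
rewrite lee_fin leNgt; apply/negP => Qp.
have p0 : 0 < p by apply: lt_trans Qp; exact: expR_gt0.
have Qlt : Q < ln p by rewrite -ltr_expR lnK.
have s0 : 0 <= \sum_j `|c j| by apply: sumr_ge0.
move: (\sum_j `|c j|) s0 mesh => s s0 mesh.
(* At this mesh width [s h < ln p - Q], which contradicts the mesh bound; [s + 1] keeps the
   denominator positive when [s = 0]. *)
have h0 : 0 < (ln p - Q) / (s + 1) by apply: divr_gt0; lra.
have := mesh _ h0; rewrite lee_fin -{1}(lnK p0) ler_expR leNgt => /negP; apply.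
have : s * ((ln p - Q) / (s + 1)) < ln p - Q.
  by rewrite mulrCA gtr_pMr ?subr_gt0// ltr_pdivrMr; lra.
lra.
Qed.

Lemma measurable_sample_mean_near (d : measure_display) (T : measurableType d)
    (R : realType) (P : probability T R) (n : nat) (X : 'I_n -> {RV P >-> R})
    (eps gam : R) :
  measurable [set w | `|n%:R^-1 * \sum_r X r w - gam| <= eps].
Proof.
rewrite -[X in measurable X]setTI; apply: measurable_fun_le => //.
apply: measurableT_comp => //; apply: measurable_funB => //.
by apply: measurable_funM => //; exact: measurable_sum.
Qed.

(** The coefficients vanish off the image of [f], so the Chernoff bound applies to the whole
    independent family and no subfamily is extracted. The boolean is the sign of the deviation, one
    for each tail. *)
Lemma sample_mean_tail (d : measure_display) (T : measurableType d)
    (R : realType) (P : probability T R) (J : finType) (X : J -> {RV P >-> R})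
    (D : J -> probability R R) (B eps gam : R) (m : J -> R)
    (n : nat) (f : 'I_n -> J) :
  (0 < n)%N -> 0 < eps <= B -> mutually_independent X ->
  (forall j A, measurable A -> distribution P (X j) A = D j A) ->
  (forall j, D j `[0, B]%classic = 1%E) ->
  (forall j, (\int[D j]_x x%:E = (m j)%:E)%E) ->
  injective f -> (forall r, m (f r) = gam) ->
  (P (~` [set w | `|n%:R^-1 * \sum_r X (f r) w - gam| <= eps]%R) <=
     (2 * expR (- (n%:R * eps ^+ 2 / (8 * B ^+ 2))))%:E)%E.
Proof.
move=> n0 /andP[eps0 epsB] indX distX D1 Dm finj fm.
have B0 : 0 < B by exact: lt_le_trans epsB.
(* This minimises [2 B^2 n lam^2 - lam n eps], with value [- n eps^2 / (8 B^2)]; moreover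
   [lam B = eps / (4 B)] is at most [1/4]. *)
pose lam := eps / (4 * B ^+ 2).
have lam0 : 0 < lam by rewrite divr_gt0// mulr_gt0// exprn_gt0.
pose c (b : bool) (j : J) := if j \in f @: 'I_n then (-1) ^+ b * lam else 0.
have cB b j : `|c b j| * B <= 2^-1.
  rewrite /c; case: ifP => _; last by rewrite normr0 mul0r invr_ge0.
  rewrite normrM normrX normrN1 expr1n mul1r gtr0_norm//.
  have -> : lam * B = eps / (4 * B) by rewrite /lam; field; rewrite gt_eqF.
  by rewrite ler_pdivrMr; lra.
have sum_c (F : J -> R) b :
    \sum_j c b j * F j = (-1) ^+ b * lam * \sum_r F (f r).
  rewrite mulr_sumr (eq_bigl (mem 'I_n))//.
  rewrite -(big_imset (fun j => (-1) ^+ b * lam * F j)) /=; last first.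
    by move=> ? ? _ _; exact: finj.
  rewrite [RHS]big_mkcond; apply: eq_bigr => j _; rewrite /c.
  by case: ifP => //; rewrite mul0r.
have n0R : 0 < n%:R :> R by rewrite ltr0n.
have meas_ev b : measurable [set w | lam * (n%:R * eps) <=
    \sum_j c b j * (X j w - m j)].
  rewrite -[X in measurable X]setTI; apply: measurable_fun_le => //.
  apply: measurable_sum => j; apply: measurable_funM => //.
  exact: measurable_funB.
have -> : 2 * expR (- (n%:R * eps ^+ 2 / (8 * B ^+ 2))) =
    \sum_(b : bool) expR (- (n%:R * eps ^+ 2 / (8 * B ^+ 2))) :> R.
  by rewrite sumr_const card_bool mulr_natl.
apply: (@measure_le_sum _ _ _ P _ _ (fun b => [set w | lam * (n%:R * eps) <=
    \sum_j c b j * (X j w - m j)])) => //.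
- by apply: measurableC; exact: measurable_sample_mean_near.
- move=> w /=; have hs b : \sum_j c b j * (X j w - m j) =
      lam * (n%:R * ((-1) ^+ b * (n%:R^-1 * \sum_r X (f r) w - gam))).
    rewrite sum_c sumrB; under [in X in _ - X]eq_bigr do rewrite fm.
    rewrite sumr_const card_ord -mulr_natl.
    move: (\sum_r X (f r) w) => s; field; rewrite gt_eqF//.
  move=> /negP; rewrite -ltNge => hw.
  exists (n%:R^-1 * (\sum_r X (f r) w) - gam < 0).
  rewrite hs ler_pM2l// ler_pM2l//; apply: ltW; apply: lt_le_trans hw _.
  by case: ltP => h; rewrite ?expr1 ?expr0 ?mulN1r ?mul1r;
    [rewrite ltr0_norm|rewrite ger0_norm].
- move=> b; apply: le_trans (chernoff _ indX distX D1 Dm (cB b)) _.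
  rewrite lee_fin ler_expR.
  have -> : \sum_j c b j ^+ 2 = n%:R * lam ^+ 2.
    under eq_bigr do rewrite expr2.
    rewrite sum_c (eq_bigr (fun=> (-1) ^+ b * lam)); last first.
      by move=> r _; rewrite /c imset_f.
    rewrite sumr_const card_ord -mulr_natl.
    have := sqrr_sign R b; rewrite expr2 => e.
    by move: ((-1) ^+ b) e => s e; ring: e.
  rewrite /lam; have B20 : B != 0 by rewrite gt_eqF.
  by rewrite le_eqVlt; apply/orP; left; apply/eqP; field.
Qed.

(** * The exploration schedule and its estimates *)

(** For [j' >= k], [insub j'] is [None], the action that keeps the state. *)
Fixpoint phase_state (k : nat) (e : rel 'I_k) (j : nat) : state k :=
  if j is j'.+1 then step e (phase_state e j') (insub j') else state0 k.

(** The history includes the current observation, so its length is a multiple of [n] exactly at the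
    end of a phase; the predecessor makes the first switch fix criterion 0. *)
Definition round_robin (A : Type) (k n : nat) (h : seq A) : option 'I_k :=
  if (n %| size h)%N then insub (size h %/ n).-1 else None.

Definition phase_of (k : nat) (i : 'I_k) (b : bool) : nat :=
  if b then i.+1 else 0%N.

Definition phase_mean (R : realType) (k n : nat) (h : seq ('I_k -> R))
    (i : 'I_k) (b : bool) : R :=
  n%:R^-1 * \sum_(r < n) nth (fun=> 0) h (phase_of i b * n + r) i.

Lemma phase_stateE (k : nat) (e : rel 'I_k) (i : 'I_k) (b : bool) :
  phase_state e (phase_of i b) i = b.
Proof.
case: b => /=; last by rewrite ffunE.
by rewrite insubT//= => ii; rewrite ffunE -val_eqE eqxx.
Qed.

(** The policy reads only the length of the history, so the states are the same for every [obs] and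
    the history is a fixed selection of the samples. *)
Lemma run_round_robin (R : realType) (k n : nat) (e : rel 'I_k) obs t :
  (0 < n)%N -> run e (@round_robin ('I_k -> R) k n) obs t =
  (phase_state e (t %/ n),
   [seq obs r (phase_state e (r %/ n)) | r <- iota 0 t]).
Proof.
move=> n0; elim: t => [|t IH]; first by rewrite div0n.
rewrite /= IH; have -> : rcons [seq obs r (phase_state e (r %/ n)) | r <- iota 0 t]
    (obs t (phase_state e (t %/ n))) =
    [seq obs r (phase_state e (r %/ n)) | r <- iota 0 t.+1].
  by rewrite -[t.+1]addn1 iotaD map_cat cats1.
rewrite -[obs 0 _ :: _]/[seq obs r (phase_state e (r %/ n)) | r <- iota 0 t.+1].
congr pair; rewrite /round_robin size_map size_iota divnS//.
by case: dvdnP => _.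
Qed.

Lemma phase_bound k n (i : 'I_k) b (r : 'I_n) :
  (phase_of i b * n + r < k.+1 * n)%N.
Proof.
have : (phase_of i b <= k)%N by case: b => //=; exact: ltn_ord.
by have := ltn_ord r; nia.
Qed.

Lemma learn_parameters (R : realType) (k n : nat) (e : rel 'I_k)
    (B eps delta : R) :
  (0 < n)%N -> (0 < k)%N -> 0 < eps <= B ->
  2 * expR (- (n%:R * eps ^+ 2 / (8 * B ^+ 2))) <= delta / (2 * k%:R) ->
  forall gam (D : 'I_k -> state k -> probability R R),
  (forall i s, D i s `[0, B]%classic = 1%E) ->
  (forall i s, (\int[D i s]_x x%:E = (mu gam s i)%:E)%E) ->
  forall (d : measure_display) (Omega : measurableType d)
    (P : probability Omega R)
    (Y : 'I_(k.+1 * n) * 'I_k * state k -> {RV P >-> R}),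
  mutually_independent Y ->
  (forall t i s A, measurable A ->
     distribution P (Y (t, i, s)) A = D i s A) ->
  let good := [set w : Omega | forall i b,
    `| phase_mean n (run e (@round_robin ('I_k -> R) k n) (observations Y w)
          (k.+1 * n)).2 i b - gam i b | <= eps] in
  measurable good /\ ((1 - delta)%:E <= P good)%E.
Proof.
move=> n0 k0 eB hn gam D D1 Dm d Omega P Y indY distY good.
(* The indices of the [n] samples behind the estimate of one parameter; they differ in their
   times. *)
pose f (ib : 'I_k * bool) (r : 'I_n) : 'I_(k.+1 * n) * 'I_k * state k :=
  (Ordinal (phase_bound ib.1 ib.2 r), ib.1, phase_state e (phase_of ib.1 ib.2)).
have f_inj ib : injective (f ib).
  by move=> r r' [/addnI]; exact: val_inj.
have meanE w i b : phase_mean n (run e (@round_robin ('I_k -> R) k n)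
    (observations Y w) (k.+1 * n)).2 i b = n%:R^-1 * \sum_r Y (f (i, b) r) w.
  rewrite run_round_robin//= /phase_mean; congr (_ * _); apply: eq_bigr => r _.
  have lt := phase_bound i b r.
  rewrite (nth_map 0%N) ?size_iota// nth_iota// add0n /observations insubT.
  rewrite divnMDl// [(r %/ n)%N]divn_small// addn0.
  by rewrite /f /=; congr (Y (_, _, _) w); exact: val_inj.
pose near (ib : 'I_k * bool) := [set w | `|n%:R^-1 * \sum_r Y (f ib r) w -
  gam ib.1 ib.2| <= eps].
have mnear ib : measurable (near ib) by exact: measurable_sample_mean_near.
have goodE : good = \bigcap_(ib in [set: 'I_k * bool]) near ib.
  apply/seteqP; split=> w /=.
    by move=> gw [i b] _; rewrite /near/= -meanE; exact: gw.
  by move=> gw i b; rewrite meanE; exact: (gw (i, b)).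
have mgood : measurable good.
  by rewrite goodE; apply: fin_bigcap_measurable.
split=> //.
have hbad : (P (~` good) <= delta%:E)%E.
  have -> : delta = \sum_(ib : 'I_k * bool) delta / (2 * k%:R).
    rewrite sumr_const card_prod card_ord card_bool -[RHS]mulr_natr natrM.
    by field; rewrite pnatr_eq0 -lt0n.
  apply: (@measure_le_sum _ _ _ P _ _ (fun ib => ~` near ib)) => //.
  - exact: measurableC.
  - by move=> ib; exact: measurableC.
  - by move=> w; rewrite goodE => /existsNP[ib /not_implyP[_ nw]]; exists ib.
  - move=> ib; apply: le_trans (_ : _ <= (2 * expR (- (n%:R * eps ^+ 2 /
        (8 * B ^+ 2))))%:E)%E _; last by rewrite lee_fin.
    apply: (@sample_mean_tail _ _ _ P _ Y (fun j => D j.1.2 j.2) _ _ _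
      (fun j => mu gam j.2 j.1.2)) => //.
    + by move=> [[t i] s] A mA; exact: distY.
    + by move=> r; rewrite /f/= /mu phase_stateE.
have : P good = (1 - P (~` good))%E.
  by rewrite -[in LHS](setCK good) probability_setC//; exact: measurableC.
move=> ->; rewrite EFinB; exact: leeB.
Qed.

(* The constant 50 comes from [k.+1 <= 2 k], the sample size
   [n <= 8 (B / eps)^2 ln (4 k / delta) + 1] and [ln 4 <= 3]. *)
Lemma sample_size (R : realType) (k : nat) (B eps delta : R) :
  (0 < k)%N -> 0 < eps <= B -> 0 < delta < 1 ->
  exists n : nat, [/\ (0 < n)%N,
    2 * expR (- (n%:R * eps ^+ 2 / (8 * B ^+ 2))) <= delta / (2 * k%:R) &
    (k.+1 * n)%:R <=
      50 * (B ^+ 2 * k%:R / eps ^+ 2) * (1 + ln (k%:R / delta))].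
Proof.
move=> k0 /andP[eps0 epsB] /andP[d0 d1].
have B0 : 0 < B by exact: lt_le_trans epsB.
have k1 : 1 <= k%:R :> R by rewrite ler1n.
have kd1 : 1 <= k%:R / delta by rewrite ler_pdivlMr//; lra.
pose l := ln (k%:R / delta); pose q := B ^+ 2 / eps ^+ 2.
have l0 : 0 <= l by exact: ln_ge0.
have q1 : 1 <= q by rewrite ler_pdivlMr ?exprn_gt0// mul1r lerXn2r// nnegrE ltW.
have ln4 : ln 4 <= 3 :> R by apply: le_trans (le_ln1Dx _) _; lra.
have ln40 : 0 <= ln 4 :> R by apply: ln_ge0; lra.
pose x := 8 * q * (ln 4 + l).
have x0 : 0 <= x by rewrite /x; nra.
have /andP[nx xn] := truncn_itv x0.
exists (Num.truncn x).+1; split=> //.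
- have : expR (- ((Num.truncn x).+1%:R * eps ^+ 2 / (8 * B ^+ 2))) <=
      expR (- (ln 4 + l)).
    rewrite ler_expR lerN2 ler_pdivlMr ?mulr_gt0 ?exprn_gt0//.
    have -> : (ln 4 + l) * (8 * B ^+ 2) = x * eps ^+ 2.
      by rewrite /x /q; field; rewrite gt_eqF.
    by rewrite ler_pM2r ?exprn_gt0// ltW.
  rewrite opprD expRD !expRN lnK ?posrE// lnK ?posrE; last by lra.
  rewrite invf_div => h; apply: le_trans (ler_wpM2l _ h) _ => //.
  rewrite le_eqVlt; apply/orP; left; apply/eqP; field.
  by rewrite gt_eqF//; lra.
- rewrite natrM -!natr1.
  have -> : B ^+ 2 * k%:R / eps ^+ 2 = q * k%:R by rewrite /q; ring.
  rewrite -/l; apply: (@le_trans _ _ (2 * k%:R * (x + 1))).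
    by apply: ler_pM; rewrite ?addr_ge0//; lra.
  (* Here [25] is [8 * 3 + 1]: [ln 4 <= 3], and the final [1] is at most [q]. *)
  have h : x + 1 <= q * (25 + 8 * l).
    have := ler_wpM2l (le_trans ler01 q1) ln4; rewrite /x; lra.
  apply: (@le_trans _ _ (2 * k%:R * (q * (25 + 8 * l)))).
    by apply: ler_wpM2l; lra.
  have q0 : 0 <= q by exact: le_trans q1.
  have : 0 <= q * k%:R * l by apply: mulr_ge0 => //; exact: mulr_ge0.
  lra.
Qed.

Lemma parameter_learning (R : realType) (k : nat) (e : rel 'I_k)
    (B eps delta : R) :
  0 <= B -> 0 < eps -> 0 < delta < 1 ->
  exists (T : nat) (pol : seq ('I_k -> R) -> option 'I_k)
         (est : seq ('I_k -> R) -> 'I_k -> bool -> R) (L : seq (state k)),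
    T%:R <= 50 * (B ^+ 2 * k%:R / eps ^+ 2) * (1 + ln (k%:R / delta)) /\
    (size L <= k.+1)%N /\
    forall gam : 'I_k -> bool -> R, (forall i b, 0 <= gam i b) ->
    forall D : 'I_k -> state k -> probability R R,
      (forall i s, D i s `[0, B]%classic = 1%E) ->
      (forall i s, (\int[D i s]_x x%:E = (mu gam s i)%:E)%E) ->
    forall (d : measure_display) (Omega : measurableType d)
           (P : probability Omega R)
           (Y : 'I_T * 'I_k * state k -> {RV P >-> R}),
      mutually_independent Y ->
      (forall t i s A, measurable A ->
         distribution P (Y (t, i, s)) A = D i s A) ->
      let good := [set w : Omega | forall i b,
            `| est (run e pol (observations Y w) T).2 i b - gam i b | <= eps] in
      measurable good /\
      ((1 - delta)%:E <= P good)%E /\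
      (forall (w : Omega) (t : nat), (t < T)%N ->
         (run e pol (observations Y w) t).1 \in L).
Proof.
move=> B0 eps0 hd; have /andP[d0 d1] := hd.
(* With no criteria, or with [B <= eps], zero steps suffice: a parameter is a mean over [[0, B]],
   hence within [eps] of the estimate [0]. *)
have [triv|] := boolP ((k == 0)%N || (B <= eps)).
  exists 0%N, (fun=> None), (fun _ _ _ => 0), [::]; split; last first.
    split=> // gam gam0 D D1 Dm d Omega P Y _ _ good.
    have -> : good = setT.
      apply/seteqP; split=> // w _ i b; rewrite sub0r normrN ger0_norm//.
      move: triv; case: eqP => [k0|_ /= Beps]; first by have := ltn_ord i; rewrite {2}k0.
      have [_ _ /andP[_]] := mean_over_support (D1 i [ffun=> b]) (Dm i [ffun=> b]).
      by rewrite /mu ffunE => /le_trans; exact.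
    by rewrite probability_setT lee_fin; do ?split => //; lra.
  have [->|k0] := posnP k; first by rewrite mulr0 mul0r mulr0 mul0r.
  have k1 : 1 <= k%:R :> R by rewrite ler1n.
  apply: mulr_ge0.
    by rewrite mulr_ge0// divr_ge0 ?sqr_ge0// mulr_ge0 ?sqr_ge0.
  by apply: addr_ge0 => //; apply: ln_ge0; rewrite ler_pdivlMr//; lra.
rewrite negb_or -lt0n -ltNge => /andP[k0 epsB].
have eB : 0 < eps <= B by rewrite eps0 ltW.
have [n [n0 hn hT]] := sample_size k0 eB hd.
exists (k.+1 * n)%N, (@round_robin ('I_k -> R) k n), (phase_mean n),
  [seq phase_state e j | j <- iota 0 k.+1]; split=> //.
split; first by rewrite size_map size_iota.
move=> gam _ D D1 Dm d Omega P Y indY distY good.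
have [mgood Pgood] := learn_parameters e n0 k0 eB hn D1 Dm indY distY.
do 2 split=> //; move=> w t tT; rewrite run_round_robin//.
by apply: (map_f (phase_state e)); rewrite mem_iota add0n ltn_divLR.
Qed.

(** * The local-ratio algorithm on the RAM *)

Notation memory R := ((nat -> nat) * (nat -> R))%type.

Definition is_control (i : instr) : bool :=
  match i with JNLe _ _ _ | JRLe _ _ _ | Halt => true | _ => false end.

(** The effect on memory of a non-control instruction does not depend on its address, so it is read
    off from a one-line program. *)
Definition exec_instr (R : realType) (i : instr) (s : memory R) : memory R :=
  let c := ram_step [:: i] (Config 0 s.1 s.2) in (nmem c, rmem c).

(** Jump targets of the machine are absolute, so compilation takes the offset of the code;
    [JNLe 0 0 l] is the unconditional jump. *)
Inductive cmd : Type :=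
| Skip
| Op of instr
| Seq of cmd & cmd
| IfN of nat & nat & cmd & cmd
| IfR of nat & nat & cmd & cmd
| While of nat & nat & cmd.

Notation "c ;; d" := (Seq c d) (at level 61, right associativity).

(* [While a b c] runs [c] as long as N[a] < N[b]; [IfN a b c d] tests
   N[a] <= N[b]. *)
Fixpoint compile (o : nat) (c : cmd) : seq instr :=
  match c with
  | Skip => [::]
  | Op i => [:: i]
  | Seq c1 c2 => compile o c1 ++ compile (o + size (compile o c1)) c2
  | IfN a b c1 c2 =>
      let e := compile o.+1 c2 in
      let l := (o.+1 + size e).+1 in
      JNLe a b l :: e ++ JNLe 0 0 (l + size (compile l c1)) :: compile l c1
  | IfR a b c1 c2 =>
      let e := compile o.+1 c2 in
      let l := (o.+1 + size e).+1 in
      JRLe a b l :: e ++ JNLe 0 0 (l + size (compile l c1)) :: compile l c1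
  | While a b c =>
      let e := compile o.+1 c in
      JNLe b a (o.+1 + size e).+1 :: e ++ [:: JNLe 0 0 o]
  end.

(** Stating this through the remaining fuel [f] makes step counts add up under composition. *)
Definition reach (R : realType) (prog : seq instr) (n : nat)
    (c c' : config R) : Prop :=
  forall f, ram_exec prog (n + f) c = ram_exec prog f c'.

Definition code_at (prog : seq instr) (o : nat) (s : seq instr) : Prop :=
  forall i, (i < size s)%N -> nth Halt prog (o + i) = nth Halt s i.

Definition runs (R : realType) (c : cmd) (s s' : memory R) (n : nat) : Prop :=
  forall prog o, code_at prog o (compile o c) ->
  reach prog n (Config o s.1 s.2)
    (Config (o + size (compile o c)) s'.1 s'.2).

Definition wp (R : realType) (c : cmd) (T : nat) (Q : memory R -> Prop)
    (s : memory R) : Prop :=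
  exists s' n, [/\ (n <= T)%N, runs c s s' n & Q s'].

Lemma reach_trans (R : realType) prog n1 n2 (c1 c2 c3 : config R) :
  reach prog n1 c1 c2 -> reach prog n2 c2 c3 -> reach prog (n1 + n2) c1 c3.
Proof. by move=> h1 h2 f; rewrite -addnA h1 h2. Qed.

Lemma code_at_cat prog o s1 s2 :
  code_at prog o (s1 ++ s2) ->
  code_at prog o s1 /\ code_at prog (o + size s1) s2.
Proof.
move=> h; split=> i hi.
  by rewrite h ?size_cat ?ltn_addr// nth_cat hi.
rewrite -addnA h ?size_cat ?ltn_add2l//.
by rewrite nth_cat ltnNge leq_addr/= addKn.
Qed.

Lemma code_at_cons prog o i s :
  code_at prog o (i :: s) -> nth Halt prog o = i /\ code_at prog o.+1 s.
Proof.
rewrite -cat1s => /code_at_cat[h1]; rewrite addn1; split=> //.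
by have := h1 0%N erefl; rewrite addn0.
Qed.

Lemma reach_op (R : realType) prog o i (s : memory R) :
  ~~ is_control i -> nth Halt prog o = i ->
  reach prog 1 (Config o s.1 s.2)
    (Config o.+1 (exec_instr i s).1 (exec_instr i s).2).
Proof. by move=> hi ho f; rewrite add1n /= ho; case: i hi ho. Qed.

Lemma reach_jump (R : realType) prog o l :
  nth Halt prog o = JNLe 0 0 l ->
  forall s : memory R, reach prog 1 (Config o s.1 s.2) (Config l s.1 s.2).
Proof. by move=> ho s f; rewrite add1n /= ho leqnn. Qed.

Lemma reach_jnle (R : realType) prog o a b l :
  nth Halt prog o = JNLe a b l ->
  forall s : memory R, reach prog 1 (Config o s.1 s.2)
    (Config (if (s.1 a <= s.1 b)%N then l else o.+1) s.1 s.2).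
Proof. by move=> ho s f; rewrite add1n /= ho. Qed.

Lemma reach_jrle (R : realType) prog o a b l :
  nth Halt prog o = JRLe a b l ->
  forall s : memory R, reach prog 1 (Config o s.1 s.2)
    (Config (if s.2 a <= s.2 b then l else o.+1) s.1 s.2).
Proof. by move=> ho s f; rewrite add1n /= ho. Qed.

Lemma wp_le (R : realType) c T T' (Q Q' : memory R -> Prop) s :
  wp c T Q s -> (T <= T')%N -> (forall s', Q s' -> Q' s') -> wp c T' Q' s.
Proof.
move=> [s' [n [hn hr hq]]] hT hQ; exists s', n; split => //; last exact: hQ.
exact: leq_trans hT.
Qed.

Lemma wp_skip (R : realType) T (Q : memory R -> Prop) s : Q s -> wp Skip T Q s.
Proof. by move=> hq; exists s, 0%N; split=> // prog o _ f; rewrite addn0. Qed.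

Lemma wp_op (R : realType) i T (Q : memory R -> Prop) s :
  ~~ is_control i -> Q (exec_instr i s) -> wp (Op i) T.+1 Q s.
Proof.
move=> hi hq; exists (exec_instr i s), 1%N; split=> // prog o.
by move=> /code_at_cons[h _]; rewrite addn1; exact: reach_op.
Qed.

Lemma wp_seq (R : realType) c1 c2 T1 T2 (Q : memory R -> Prop) s :
  wp c1 T1 (wp c2 T2 Q) s -> wp (c1 ;; c2) (T1 + T2) Q s.
Proof.
move=> [s1 [n1 [hn1 hr1 [s2 [n2 [hn2 hr2 hq]]]]]].
exists s2, (n1 + n2)%N; split=> //; first exact: leq_add.
move=> prog o /= /code_at_cat[h1 h2]; apply: reach_trans (hr1 _ _ h1) _.
by rewrite size_cat addnA; exact: hr2.
Qed.

Lemma wp_opS (R : realType) i c T (Q : memory R -> Prop) s :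
  ~~ is_control i -> wp c T Q (exec_instr i s) -> wp (Op i ;; c) T.+1 Q s.
Proof. by move=> hi h; rewrite -add1n; apply: wp_seq; exact: wp_op. Qed.

(** The two extra steps are the test and, after [c2], which is laid out first, the jump over
    [c1]. *)
Lemma wp_ifN (R : realType) a b c1 c2 T (Q : memory R -> Prop) s :
  ((s.1 a <= s.1 b)%N -> wp c1 T Q s) ->
  ((s.1 b < s.1 a)%N -> wp c2 T Q s) -> wp (IfN a b c1 c2) T.+2 Q s.
Proof.
case: leqP => hab h1 h2.
  have [//|s' [n [hn hr hq]]] := h1; exists s', n.+1; split=> //.
    by lia.
  move=> prog o /= /code_at_cons[/reach_jnle/(_ s) hj].
  move=> /code_at_cat[_ /code_at_cons[_ hc]].
  rewrite -add1n; apply: reach_trans hj _; rewrite hab.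
  by have := hr _ _ hc; congr (reach _ _ _ (Config _ _ _)); rewrite size_cat/=; lia.
have [//|s' [n [hn hr hq]]] := h2; exists s', n.+2; split=> //.
move=> prog o /= /code_at_cons[/reach_jnle/(_ s) hj].
move=> /code_at_cat[hc /code_at_cons[/reach_jump/(_ s') hj' _]].
rewrite -add1n; apply: reach_trans hj _; rewrite leqNgt hab /=.
rewrite -addn1; apply: reach_trans (hr _ _ hc) _.
by move: hj'; congr (reach _ _ _ (Config _ _ _)); rewrite size_cat/=; lia.
Qed.

Lemma wp_ifR (R : realType) a b c1 c2 T (Q : memory R -> Prop) s :
  (s.2 a <= s.2 b -> wp c1 T Q s) ->
  (s.2 b < s.2 a -> wp c2 T Q s) -> wp (IfR a b c1 c2) T.+2 Q s.
Proof.
case: leP => hab h1 h2.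
  have [//|s' [n [hn hr hq]]] := h1; exists s', n.+1; split=> //.
    by lia.
  move=> prog o /= /code_at_cons[/reach_jrle/(_ s) hj].
  move=> /code_at_cat[_ /code_at_cons[_ hc]].
  rewrite -add1n; apply: reach_trans hj _; rewrite hab.
  by have := hr _ _ hc; congr (reach _ _ _ (Config _ _ _)); rewrite size_cat/=; lia.
have [//|s' [n [hn hr hq]]] := h2; exists s', n.+2; split=> //.
move=> prog o /= /code_at_cons[/reach_jrle/(_ s) hj].
move=> /code_at_cat[hc /code_at_cons[/reach_jump/(_ s') hj' _]].
rewrite -add1n; apply: reach_trans hj _; rewrite leNgt hab /=.
rewrite -addn1; apply: reach_trans (hr _ _ hc) _.
by move: hj'; congr (reach _ _ _ (Config _ _ _)); rewrite size_cat/=; lia.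
Qed.

Lemma wp_while_end (R : realType) a b c T (Q : memory R -> Prop) s :
  (s.1 b <= s.1 a)%N -> Q s -> wp (While a b c) T.+1 Q s.
Proof.
move=> hab hq; exists s, 1%N; split=> // prog o /= /code_at_cons[].
move=> /reach_jnle/(_ s); rewrite hab => hj _.
by move: hj; congr (reach _ _ _ (Config _ _ _)); rewrite size_cat/=; lia.
Qed.

Lemma wp_while_step (R : realType) a b c T T' (Q : memory R -> Prop) s :
  (s.1 a < s.1 b)%N -> wp c T (wp (While a b c) T' Q) s ->
  wp (While a b c) (T + T').+2 Q s.
Proof.
move=> hab [s1 [n1 [hn1 hr1 [s2 [n2 [hn2 hr2 hq]]]]]].
exists s2, (n1 + n2).+2; split=> //; first by rewrite !ltnS leq_add.
move=> prog o hco; have := hr2 _ _ hco; move: hco.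
move=> /= /code_at_cons[/reach_jnle/(_ s) hj].
move=> /code_at_cat[hc /code_at_cons[/reach_jump/(_ s1) hj' _]] hw.
have -> : (n1 + n2).+2 = (1 + (n1 + (1 + n2)))%N by lia.
apply: reach_trans hj _; rewrite leqNgt hab /=.
apply: reach_trans (hr1 _ _ hc) _; apply: reach_trans hj' _.
exact: hw.
Qed.

(** The final index is [maxn i0 n] because a loop may start beyond its bound: the copying loop
    starts at 1 even when [k = 0]. *)
Lemma wp_for (R : realType) (I : nat -> memory R -> Prop) a b c n T i0 s :
  (forall i s, I i s -> s.1 a = i /\ s.1 b = n) ->
  (forall i s, (i < n)%N -> I i s -> wp c T (I i.+1) s) ->
  I i0 s -> wp (While a b c) ((n - i0) * T.+2).+1 (I (maxn i0 n)) s.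
Proof.
move=> hI hc; move hm: (n - i0)%N => m.
elim: m i0 hm s => [|m IH] i0 hm s h0; have [ha hb] := hI _ _ h0.
  apply: wp_while_end; first by rewrite ha hb; lia.
  by have -> : maxn i0 n = i0 by lia.
have hi : (i0 < n)%N by lia.
have -> : (m.+1 * T.+2).+1 = (T + (m * T.+2).+1).+2 by lia.
apply: wp_while_step; first by rewrite ha hb.
apply: (wp_le (hc _ _ hi h0)) => // s' hs'.
have -> : maxn i0 n = maxn i0.+1 n by lia.
by apply: IH => //; lia.
Qed.

(** Control falls off the end of the code, where [nth] returns its default [Halt]. *)
Lemma wp_exec (R : realType) c T (Q : memory R -> Prop) s :
  wp c T Q s -> exists c', ram_exec (compile 0 c) T (Config 0 s.1 s.2) = Some c'
    /\ Q (nmem c', rmem c').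
Proof.
move=> [s' [n [hn hr hq]]].
have h : code_at (compile 0 c) 0 (compile 0 c) by [].
have := hr _ _ h (T - n)%N; rewrite subnKC// => ->.
exists (Config (0 + size (compile 0 c)) s'.1 s'.2); split; last by case: s' hr hq.
by case: (T - n)%N => [|f] /=; rewrite nth_default.
Qed.

(* Register bank of nat cells [b .. b + 7]. Real cells 0 and 1 serve as scratch
   registers, after the input has been copied to the real cells starting at
   [2 k + 2], which is the value kept in nat cell [b.+1]; nat cell [b] holds 1. *)
Definition copy_input (b : nat) : cmd :=
  Op (NSet b 1) ;; Op (NAdd (b + 7) 0 0) ;; Op (NSet (b + 5) 2) ;;
  Op (NAdd (b + 1) (b + 7) (b + 5)) ;; Op (RStore (b + 1) 0) ;;
  Op (NSet (b + 2) 1) ;;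
  While (b + 2) (b + 7)
    (Op (RLoad 0 (b + 2)) ;; Op (NAdd (b + 6) (b + 1) (b + 2)) ;;
     Op (RStore (b + 6) 0) ;; Op (NAdd (b + 2) (b + 2) b)).

Definition compute_weights (b : nat) : cmd :=
  Op (NSet (b + 2) 0) ;;
  While (b + 2) 0
    (Op (NAdd (b + 5) (b + 1) (b + 2)) ;; Op (NAdd (b + 6) (b + 5) 0) ;;
     Op (RLoad 0 (b + 5)) ;; Op (RLoad 1 (b + 6)) ;;
     IfR 0 1 (Op (RZero 0)) (Op (RSub 0 0 1)) ;;
     Op (RStore (b + 5) 0) ;; Op (NAdd (b + 2) (b + 2) b)).

Definition pay_edge (b : nat) : cmd :=
  Op (NAdd (b + 5) (b + 1) (b + 2)) ;; Op (NAdd (b + 6) (b + 1) (b + 3)) ;;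
  Op (RLoad 0 (b + 5)) ;; Op (RLoad 1 (b + 6)) ;;
  IfR 0 1 (Op (RSub 1 1 0) ;; Op (RZero 0)) (Op (RSub 0 0 1) ;; Op (RZero 1)) ;;
  Op (RStore (b + 5) 0) ;; Op (RStore (b + 6) 1).

(** Cell [b + 4] holds the address [1 + u * k] of row [u], advanced by additions; after the last row
    it is the output address. Only pairs [v < u] are scanned, so each edge pays once and row 0 is
    never read. *)
Definition pay_edges (b : nat) : cmd :=
  Op (NSet (b + 2) 0) ;; Op (NSet (b + 4) 1) ;;
  While (b + 2) 0
    (Op (NSet (b + 3) 0) ;;
     While (b + 3) (b + 2)
       (Op (NAdd (b + 6) (b + 4) (b + 3)) ;; Op (NLoad (b + 7) (b + 6)) ;;
        IfN b (b + 7) (pay_edge b) Skip ;;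
        Op (NAdd (b + 3) (b + 3) b)) ;;
     Op (NAdd (b + 4) (b + 4) 0) ;; Op (NAdd (b + 2) (b + 2) b)).

(** Output cells start at 0, so only positive residuals require a store. *)
Definition write_output (b : nat) : cmd :=
  Op (NSet (b + 2) 0) ;; Op (RZero 1) ;;
  While (b + 2) 0
    (Op (NAdd (b + 5) (b + 1) (b + 2)) ;; Op (RLoad 0 (b + 5)) ;;
     Op (NAdd (b + 6) (b + 4) (b + 2)) ;;
     IfR 0 1 Skip (Op (NStore (b + 6) b)) ;;
     Op (NAdd (b + 2) (b + 2) b)).

Definition local_ratio (b : nat) : cmd :=
  copy_input b ;; compute_weights b ;; pay_edges b ;; write_output b.

(** * Correctness of the program blocks and of the local-ratio argument *)

Definition setup (b k : nat) (N0 N : nat -> nat) : Prop :=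
  [/\ N b = 1%N, N (b + 1)%N = (k + k + 2)%N &
      forall a, (a < b)%N || (b + 8 <= a)%N -> N a = N0 a].

Lemma upd_same (A : Type) (f : nat -> A) a v : upd f a v a = v.
Proof. by rewrite /upd eqxx. Qed.

Lemma upd_other (A : Type) (f : nat -> A) a v n : n != a -> upd f a v n = f n.
Proof. by rewrite /upd => /negPf ->. Qed.

Ltac upds := repeat match goal with
  |- context [upd ?f ?a ?v ?n] =>
    first [ rewrite (@upd_same _ f a v) | rewrite (@upd_other _ f a v n); [|by lia] ]
  end.

(** Real cell 0 is saved before the loop turns it into scratch, hence the start at index 1. *)
Lemma wp_copy_input (R : realType) b k (N0 : nat -> nat) (M0 : nat -> R) :
  (0 < b)%N -> N0 0%N = k ->
  wp (copy_input b) (12 * k + 20)%N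
    (fun s : memory R => setup b k N0 s.1 /\
       forall j, (j < k + k)%N -> s.2 (k + k + 2 + j)%N = M0 j) (N0, M0).
Proof.
move=> b0 hk.
pose I (i : nat) (s : memory R) := [/\ setup b k N0 s.1,
  (0 < i)%N /\ s.1 (b + 2)%N = i, s.1 (b + 7)%N = (k + k)%N,
  (forall j, (0 < j < k + k)%N -> s.2 j = M0 j) &
  forall j, (j < i)%N -> (j < k + k)%N -> s.2 (k + k + 2 + j)%N = M0 j].
apply: (@wp_le _ _ (6 + ((k + k - 1) * 6).+1)%N _
  (I (maxn 1 (k + k)%N))); last 2 first.
- by lia.
- by move=> s [hs _ _ _ h]; split=> // j hj; apply: h => //; lia.
do 6 (apply: wp_opS => //); rewrite /exec_instr/=.
apply: (@wp_for _ I _ _ _ (k + k)%N).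
- by move=> i s [? []].
- move=> i [N M] hi [[/= h1 hF hN] [i0 hi'] hL hM hC].
  do 3 (apply: wp_opS => //); apply: wp_op => //; rewrite /exec_instr/=.
  split=> /=.
  + by split; rewrite /=; upds => // a ha; upds; exact: hN.
  + by split=> //; upds; lia.
  + by upds.
  + move=> j hj; upds; exact: hM.
  + move=> j hj1 hj2; upds; rewrite hF hi'.
    have [->|hji] := eqVneq j i; first by upds; apply: hM; lia.
    by upds; apply: hC => //; lia.
- split=> /=.
  + by split; upds; rewrite ?hk// => a ha; upds.
  + by split=> //; upds.
  + by upds; rewrite hk.
  + move=> j hj; rewrite upd_other//; upds. lia.
  + by case=> // _ _; upds; rewrite hk addn0 upd_same.
Qed.

Definition weight (R : realType) (M : nat -> R) (k i : nat) : R :=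
  Num.max (M i - M (k + i)%N) 0.

Lemma wp_compute_weights (R : realType) b k N0 (M0 : nat -> R) s :
  (0 < b)%N -> N0 0%N = k -> setup b k N0 s.1 ->
  (forall j, (j < k + k)%N -> s.2 (k + k + 2 + j)%N = M0 j) ->
  wp (compute_weights b) (11 * k + 10)%N
    (fun s : memory R => setup b k N0 s.1 /\
       forall j, (j < k)%N -> s.2 (k + k + 2 + j)%N = weight M0 k j) s.
Proof.
move=> b0 hk hs hM0; have hN00 N : setup b k N0 N -> N 0%N = k.
  by move=> [_ _ ->] //; rewrite b0.
pose I (i : nat) (s : memory R) := [/\ setup b k N0 s.1, s.1 (b + 2)%N = i,
  (forall j, (j < i)%N -> (j < k)%N -> s.2 (k + k + 2 + j)%N = weight M0 k j),
  (forall j, (i <= j < k)%N -> s.2 (k + k + 2 + j)%N = M0 j) &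
  (forall j, (j < k)%N -> s.2 (k + k + 2 + k + j)%N = M0 (k + j)%N)].
apply: (@wp_le _ _ (1 + ((k - 0) * 11).+1)%N _ (I (maxn 0 k))); last 2 first.
- by lia.
- by move=> s' [? _ h _ _]; split=> // j hj; apply: h => //; rewrite max0n.
apply: wp_opS => //; rewrite /exec_instr/=.
apply: (@wp_for _ I _ _ _ k); last first.
- move: hs hM0; case: s => N M /= [h1 hF hN] hM.
  split=> //=; first by split; upds => // a ha; upds; exact: hN.
  + by upds.
  + by move=> j hj; apply: hM; lia.
  + by move=> j hj; rewrite -hM; [congr M; lia | lia].
- move=> i {hs hM0 s} [N M] hi [[/= h1 hF hN] hi' hw hg0 hg1].
  have hN0 : N 0%N = k by apply: hN00.
  do 4 (apply: wp_opS => //).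
  apply: (@wp_seq _ _ _ 3 2); rewrite /exec_instr/=.
  have e0 : M (N (b + 1) + N (b + 2))%N = M0 i.
    by rewrite hF hi' hg0// leqnn.
  have e1 : M (N (b + 1) + N (b + 2) + N 0%N)%N = M0 (k + i)%N.
    by rewrite hF hi' hN0 -hg1//; congr M; lia.
  (* The common tail of both branches: the weight overwrites the copy of [gam i false] in place. *)
  have post x : x = weight M0 k i -> forall M', M' 0%N = x ->
      (forall j, (1 < j)%N -> M' j = M j) -> forall N',
      setup b k N0 N' -> N' (b + 2)%N = i -> N' (b + 5)%N = (k + k + 2 + i)%N ->
      wp (Op (RStore (b + 5) 0) ;; Op (NAdd (b + 2) (b + 2) b)) 2
        (I i.+1) (N', M').
    move=> -> M' hM0 hM N' [h1' hF' hN'] hi'' hp.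
    apply: wp_opS => //; apply: wp_op => //; rewrite /exec_instr/=; split=> /=.
    - by split; upds => // a ha; upds; exact: hN'.
    - by upds; lia.
    - move=> j hj hjk; rewrite hp; have [->|ji] := eqVneq j i.
        by upds.
      by upds; rewrite hM; [apply: hw|]; lia.
    - by move=> j hj; rewrite hp; upds; rewrite hM; [apply: hg0|]; lia.
    - by move=> j hj; rewrite hp; upds; rewrite hM; [apply: hg1|]; lia.
  apply: wp_ifR => /=; upds; rewrite e0 e1 => hle.
  + apply: wp_op => //; rewrite /exec_instr/=.
    apply: (post 0).
    * by rewrite /weight; apply/esym/max_idPr; rewrite subr_le0.
    * by upds.
    * by move=> j hj; upds.
    * by split; upds => // a ha; upds; exact: hN.
    * by upds.
    * by upds; rewrite hF hi'.
  + apply: wp_op => //; rewrite /exec_instr/=.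
    apply: (post (M0 i - M0 (k + i)%N)).
    * by rewrite /weight; apply/esym/max_idPl; rewrite subr_ge0 ltW.
    * by upds.
    * by move=> j hj; upds.
    * by split; upds => // a ha; upds; exact: hN.
    * by upds.
    * by upds; rewrite hF hi'.
- by move=> i s' [/hN00].
Qed.

(* [w - r] is what has been paid so far; the vertices outside an independent set
   cover every edge, so they receive at least half of every payment. *)
Definition local_ratio_inv (R : realType) (k : nat) (e : rel 'I_k)
    (w : 'I_k -> R) (paid : rel 'I_k) (r : 'I_k -> R) : Prop :=
  [/\ forall i, 0 <= r i <= w i,
      forall s : state k, independent e s ->
        \sum_i (w i - r i) <= 2 * \sum_(i | ~~ s i) (w i - r i) &
      forall u v, paid u v -> e u v -> r u = 0 \/ r v = 0].

(** Paying the minimum brings one end of [u v] to zero, and earlier zeros persist because residuals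
    only decrease and stay nonnegative. Both sides of the second clause grow by multiples of [m]:
    [2 m] against [2 m] for each end outside [s]. *)
Lemma local_ratio_step (R : realType) k (e : rel 'I_k) (w : 'I_k -> R)
    (paid paid' : rel 'I_k) r r' u v m :
  irreflexive e -> local_ratio_inv e w paid r ->
  e u v -> m = Num.min (r u) (r v) ->
  (forall i, r' i = r i - (if (i == u) || (i == v) then m else 0)) ->
  (forall x y, paid' x y -> paid x y \/ (x = u /\ y = v)) ->
  local_ratio_inv e w paid' r'.
Proof.
move=> irr [h1 h2 h3] euv hm hr' hp.
have uv : u != v by apply/eqP => uv; move: euv; rewrite uv irr.
have m0 : 0 <= m by rewrite hm le_min; have /andP[-> _] := h1 u; have /andP[-> _] := h1 v.
have mu : m <= r u by rewrite hm ge_min lexx.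
have mv : m <= r v by rewrite hm ge_min lexx orbT.
have r'le i : 0 <= r' i <= r i.
  rewrite hr'; have /andP[ri _] := h1 i.
  case: ifPn => [/orP[]/eqP ->|_]; apply/andP; split; lra.
split.
- move=> i; have /andP[-> h] := r'le i; have /andP[_ h'] := h1 i.
  by rewrite (le_trans h).
- move=> s hs; have hsum (p : pred 'I_k) : \sum_(i | p i) (w i - r' i) =
      \sum_(i | p i) (w i - r i) + ((p u)%:R + (p v)%:R) * m.
    have -> : \sum_(i | p i) (w i - r' i) = \sum_(i | p i) (w i - r i) +
        \sum_(i | p i) (if (i == u) || (i == v) then m else 0).
      by rewrite -big_split; apply: eq_bigr => i _; rewrite hr'/= opprB addrA addrAC.
    congr (_ + _); rewrite big_mkcond (bigD1 u)//= (bigD1 v) 1?eq_sym//= big1.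
      rewrite !eqxx orbT/= addr0 mulrDl.
      by case: (p u); case: (p v) => /=; rewrite ?mul1r ?mul0r.
    by move=> i /andP[/negPf -> /negPf ->]; case: ifP.
  rewrite !hsum mulrDr; apply: lerD; first exact: h2.
  rewrite mulrA ler_wpM2r//.
  move/forallP/(_ u)/forallP/(_ v): hs; rewrite euv/= negb_and.
  by case: (s u); case: (s v) => //= _; lra.
- move=> x y /hp[pxy|[-> ->] _].
    move=> /(h3 _ _ pxy); case=> hz; [left|right].
      by have := r'le x; rewrite hz => /le_anti.
    by have := r'le y; rewrite hz => /le_anti.
  rewrite !hr' !eqxx orbT/= hm; have [?|?] := leP (r u) (r v); [left|right]; lra.
Qed.

Lemma local_ratio_approx (R : realType) k (e : rel 'I_k)
    (gam : 'I_k -> bool -> R) (r : 'I_k -> R) (s' : state k) :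
  (forall i b, 0 <= gam i b) ->
  local_ratio_inv e (fun i => Num.max (gam i false - gam i true) 0) e r ->
  (forall i, s' i = (0 < r i)) ->
  independent e s' /\
  forall s : state k, independent e s -> g gam s' <= 2 * g gam s.
Proof.
move=> hg; set w := (fun i => _) => -[h1 h2 h3] hs'; split.
  apply/forallP => u; apply/forallP => v; apply/implyP => euv.
  rewrite !hs'; apply/negP => /andP[ru rv].
  by case: (h3 _ _ euv euv) => h; [move: ru|move: rv]; rewrite h ltxx.
move=> s /h2 hs.
pose m i := Num.min (gam i false) (gam i true).
have m0 i : 0 <= m i by rewrite le_min !hg.
have wm i : [/\ gam i true <= gam i false, w i = gam i false - gam i true &
    m i = gam i true] \/ [/\ gam i false < gam i true, w i = 0 & m i = gam i false].
  rewrite /w /m; have [h|h] := leP (gam i true) (gam i false); [left|right].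
    by split=> //; apply/max_idPl; rewrite subr_ge0.
  by split=> //; apply/max_idPr; rewrite subr_le0 ltW.
(* Equality holds because a fixed criterion has [0 < r i <= w i], so fixing it is the cheaper
   option; a general [s] satisfies only the inequality [gs]. *)
have gs' : g gam s' = \sum_i m i + \sum_(i | ~~ s' i) w i.
  rewrite (big_mkcond (fun i => ~~ s' i)) -big_split; apply: eq_bigr => i _ /=.
  rewrite /mu hs'; have /andP[r0] := h1 i; rewrite -/(w i).
  case: ltP => ri /=; case: (wm i) => -[h -> ->] rw.
  - by rewrite addr0.
  - by lra.
  - by rewrite addrC subrK.
  - by rewrite addr0.
have gs : \sum_i m i + \sum_(i | ~~ s i) w i <= g gam s.
  rewrite (big_mkcond (fun i => ~~ s i)) -big_split; apply: ler_sum => i _ /=.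
  by rewrite /mu; case: (s i); case: (wm i) => -[h -> ->] /=; lra.
have sm0 : 0 <= \sum_i m i by apply: sumr_ge0.
(* A criterion left unfixed by [s'] has residual zero, so its weight is fully paid. *)
have e1 : \sum_(i | ~~ s' i) w i <= \sum_i (w i - r i).
  rewrite (big_mkcond (fun i => ~~ s' i)); apply: ler_sum => i _.
  rewrite hs'; have /andP[r0 rw] := h1 i.
  by case: ltP => /= ?; lra.
have e2 : \sum_(i | ~~ s i) (w i - r i) <= \sum_(i | ~~ s i) w i.
  by apply: ler_sum => i _; have /andP[? _] := h1 i; lra.
rewrite gs'; move: (\sum_i m i) (\sum_(i | ~~ s' i) w i) (\sum_i (w i - r i))
  (\sum_(i | ~~ s i) (w i - r i)) (\sum_(i | ~~ s i) w i) sm0 e1 e2 gs hs.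
by move=> *; lra.
Qed.

Lemma wp_pay_edge (R : realType) b k N0 (s : memory R) u v :
  (0 < b)%N -> setup b k N0 s.1 -> s.1 (b + 2)%N = u -> s.1 (b + 3)%N = v ->
  (v < u < k)%N ->
  wp (pay_edge b) 10 (fun s' : memory R =>
    [/\ setup b k N0 s'.1, s'.1 (b + 2)%N = u, s'.1 (b + 3)%N = v,
      s'.1 (b + 4)%N = s.1 (b + 4)%N &
      forall i, s'.2 (k + k + 2 + i)%N = s.2 (k + k + 2 + i)%N -
        (if (i == u) || (i == v) then
           Num.min (s.2 (k + k + 2 + u)%N) (s.2 (k + k + 2 + v)%N) else 0)]) s.
Proof.
case: s => N M /= b0 [h1 hF hN] hu hv /andP[vu uk].
do 4 (apply: wp_opS => //).
apply: (@wp_seq _ _ _ 4 2); rewrite /exec_instr/=.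
(* The common tail of both branches; the two target cells differ because [v < u]. *)
have store m x y : m = Num.min (M (k + k + 2 + u)%N) (M (k + k + 2 + v)%N) ->
    x = M (k + k + 2 + u)%N - m -> y = M (k + k + 2 + v)%N - m ->
    forall N', setup b k N0 N' -> N' (b + 2)%N = u -> N' (b + 3)%N = v ->
    N' (b + 4)%N = N (b + 4)%N -> N' (b + 5)%N = (k + k + 2 + u)%N ->
    N' (b + 6)%N = (k + k + 2 + v)%N ->
    forall M', M' 0%N = x -> M' 1%N = y -> (forall j, (1 < j)%N -> M' j = M j) ->
    wp (Op (RStore (b + 5) 0) ;; Op (RStore (b + 6) 1)) 2 (fun s' : memory R =>
    [/\ setup b k N0 s'.1, s'.1 (b + 2)%N = u, s'.1 (b + 3)%N = v,
      s'.1 (b + 4)%N = N (b + 4)%N &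
      forall i, s'.2 (k + k + 2 + i)%N = M (k + k + 2 + i)%N -
        (if (i == u) || (i == v) then
           Num.min (M (k + k + 2 + u)%N) (M (k + k + 2 + v)%N) else 0)]) (N', M').
  move=> hm hx hy N' hs h2 h3 h4 h5 h6 M' hM0 hM1 hM.
  apply: wp_opS => //; apply: wp_op => //; rewrite /exec_instr/=; split=> //= i.
  rewrite h5 h6 -hm; have [->|iu] := eqVneq i u; first by upds; rewrite hM0 hx.
  have [->|iv] := eqVneq i v; first by upds; rewrite hM1 hy.
  by upds; rewrite hM ?subr0//; lia.
apply: wp_ifR => /=; upds; rewrite hF hu hv => hle;
  apply: wp_opS => //; apply: wp_op => //; rewrite /exec_instr/=.
- apply: (@store (M (k + k + 2 + u)%N) 0 (M (k + k + 2 + v)%N - M (k + k + 2 + u)%N));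
    rewrite ?subrr//; upds; rewrite ?hF ?hu ?hv//.
  + by apply/esym/min_idPl.
  + by split; upds => // a ha; upds; exact: hN.
  + by move=> j hj; upds.
- apply: (@store (M (k + k + 2 + v)%N) (M (k + k + 2 + u)%N - M (k + k + 2 + v)%N) 0);
    rewrite ?subrr//; upds; rewrite ?hF ?hu ?hv//.
  + by apply/esym/min_idPr/ltW.
  + by split; upds => // a ha; upds; exact: hN.
  + by move=> j hj; upds.
Qed.

Lemma local_ratio_inv_sub (R : realType) k (e : rel 'I_k) (w : 'I_k -> R)
    (paid paid' : rel 'I_k) r :
  (forall x y, e x y -> paid' x y -> paid x y) ->
  local_ratio_inv e w paid r -> local_ratio_inv e w paid' r.
Proof. by move=> hp [h1 h2 h3]; split=> // u v p' euv; apply: h3 => //; exact: hp. Qed.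

Lemma wp_pay_edges (R : realType) b k N0 (e : rel 'I_k) (w : 'I_k -> R)
    (s : memory R) :
  (0 < b)%N -> N0 0%N = k -> irreflexive e ->
  (forall u v : 'I_k, (v < u)%N -> N0 (1 + u * k + v)%N = e u v) ->
  (forall u v, (v < u < k)%N ->
    (1 + u * k + v < b)%N || (b + 8 <= 1 + u * k + v)%N) ->
  setup b k N0 s.1 -> (forall i, 0 <= w i) ->
  (forall i : 'I_k, s.2 (k + k + 2 + i)%N = w i) ->
  wp (pay_edges b) (3 + k * (k * 17 + 6))%N (fun s' : memory R =>
    [/\ setup b k N0 s'.1, s'.1 (b + 4)%N = (1 + k * k)%N &
      local_ratio_inv e w (fun x y => (y < x)%N)
        (fun i => s'.2 (k + k + 2 + i)%N)]) s.
Proof.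
move=> b0 hk irr hadj hfree hs w0 hM; have hN00 N : setup b k N0 N -> N 0%N = k.
  by move=> [_ _ ->] //; rewrite b0.
pose I (u : nat) (s : memory R) := [/\ setup b k N0 s.1, s.1 (b + 2)%N = u,
  s.1 (b + 4)%N = (1 + u * k)%N &
  local_ratio_inv e w (fun x y => (y < x < u)%N) (fun i => s.2 (k + k + 2 + i)%N)].
apply: (@wp_le _ _ (2 + ((k - 0) * (k * 17 + 6)).+1)%N _ (I (maxn 0 k))); last 2 first.
- by lia.
- move=> s' [h1 _ h2 h3]; rewrite max0n in h2 h3; split=> //.
  by apply: local_ratio_inv_sub h3 => x y _ ->; rewrite ltn_ord.
do 2 apply: wp_opS => //; rewrite /exec_instr/=.
have -> : (k * 17 + 6 = (k * 17 + 4).+2)%N by lia.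
apply: (@wp_for _ I _ _ _ k); last first.
- move: hs hM; case: s => N M /= [h1 hF hN] hM.
  split=> //=; first by split; upds => // a ha; upds; exact: hN.
  + by upds.
  + by upds.
  + split=> //.
    * by move=> i; rewrite hM w0 lexx.
    * move=> st _; rewrite !big1 ?mulr0// => i _; by rewrite hM subrr.
    * by move=> x y; rewrite ltn0 andbF.
- move=> u {hs hM s} [N M] hu [[/= h1 hF hN] hu' hrow hL].
  pose J (v : nat) (s : memory R) := [/\ setup b k N0 s.1, s.1 (b + 2)%N = u,
    s.1 (b + 3)%N = v, s.1 (b + 4)%N = (1 + u * k)%N &
    local_ratio_inv e w (fun x y => (y < x < u)%N || ((x == u :> nat) && (y < v)%N))
      (fun i => s.2 (k + k + 2 + i)%N)].
  apply: (@wp_le _ _ (1 + (((u - 0) * 17).+1 + 2))%N _ (I u.+1)) => //; last first.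
    by lia.
  apply: wp_opS => //; rewrite /exec_instr/=; apply: wp_seq.
  apply: (@wp_le _ _ ((u - 0) * 17).+1 _ (J (maxn 0 u))) => //; last first.
    move=> [N' M']; rewrite max0n => -[/= hs' hu'' hv' hrow' hL'].
    apply: wp_opS => //; apply: wp_op => //; rewrite /exec_instr/=.
    have hk' := hN00 _ hs'; case: hs' => h1' hF' hN'.
    split=> /=.
    + by split; upds => // a ha; upds; exact: hN'.
    + by upds; rewrite hu'' h1' addn1.
    + by upds; rewrite hrow' hk' mulSn; lia.
    + apply: local_ratio_inv_sub hL' => x y _; lia.
  apply: (@wp_for _ J _ _ _ u); last first.
  + split=> //=; first by split; upds => // a ha; upds; exact: hN.
    * by upds.
    * by upds.
    * by upds.
    * by apply: local_ratio_inv_sub hL => x y _; rewrite ltn0 andbF orbF.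
  + move=> v {N M h1 hF hN hu' hrow hL} [N M] hv [[/= h1 hF hN] hu' hv' hrow hL].
    do 2 apply: wp_opS => //; rewrite /exec_instr/=; upds.
    have vk : (v < k)%N by exact: ltn_trans hu.
    pose uo := Ordinal hu; pose vo := Ordinal vk.
    have hfr : (1 + u * k + v < b)%N || (b + 8 <= 1 + u * k + v)%N.
      by apply: hfree; rewrite hv.
    have hval : upd N (b + 6) (N (b + 4) + N (b + 3))%N
        (N (b + 4) + N (b + 3))%N = e uo vo.
      by rewrite hrow hv' upd_other ?hN -?(hadj uo vo)//; lia.
    rewrite hval; apply: (@wp_seq _ _ _ 12 1).
    apply: (@wp_le _ _ 12 _ (fun s' => [/\ setup b k N0 s'.1, s'.1 (b + 2)%N = u,
        s'.1 (b + 3)%N = v, s'.1 (b + 4)%N = (1 + u * k)%N &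
        local_ratio_inv e w
          (fun x y => (y < x < u)%N || ((x == u :> nat) && (y < v.+1)%N))
          (fun i => s'.2 (k + k + 2 + i)%N)])) => //; last first.
      move=> [N' M'] /= [[h1' hF' hN'] hu'' hv'' hrow' hL'].
      apply: wp_op => //; rewrite /exec_instr/=; split=> //=.
      * by split; upds => // a ha; upds; exact: hN'.
      * by upds.
      * by upds; rewrite h1' hv'' addn1.
      * by upds.
    apply: wp_ifN => /=; upds; rewrite h1 => he.
    * have euv : e uo vo by move: he; case: (e uo vo).
      apply: (wp_le (@wp_pay_edge _ b k N0 _ u v _ _ _ _ _)) => //=; upds => //.
      - by split; upds => // a ha; upds; exact: hN.
      - by rewrite hv hu.
      move=> [N' M'] /= [hs' hu'' hv'' hrow' hM']; split=> //.
        by rewrite hrow'; upds.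
      apply: (local_ratio_step (u := uo) (v := vo) irr hL euv erefl).
        by move=> i; rewrite hM'.
      move=> x y h; have [xy|nxy] := boolP ((x == uo) && (y == vo)).
        by right; case/andP: xy => /eqP-> /eqP->.
      left; move: h nxy; rewrite -!val_eqE/=; lia.
    * apply: wp_skip; split=> //=; upds => //.
        by split; upds => // a ha; upds; exact: hN.
      (* The pair added to the scanned ones is not an edge, so nothing has to be paid for it. *)
      apply: local_ratio_inv_sub hL => x y exy.
      have [xy|nxy] := boolP ((x == uo) && (y == vo)).
        case/andP: xy => /eqP xu /eqP yv; move: he; rewrite -xu -yv exy.
        by [].
      move: nxy; rewrite -!val_eqE/=; lia.
  + by move=> i s' [].
- by move=> i s' [/hN00].
Qed.

Lemma wp_write_output (R : realType) b k N0 (s : memory R) :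
  (0 < b)%N -> N0 0%N = k ->
  (forall i, (i < k)%N -> N0 (1 + k * k + i)%N = 0%N) ->
  (forall i, (i < k)%N ->
    (1 + k * k + i < b)%N || (b + 8 <= 1 + k * k + i)%N) ->
  setup b k N0 s.1 -> s.1 (b + 4)%N = (1 + k * k)%N ->
  wp (write_output b) (3 + k * 9)%N (fun s' : memory R =>
    forall i, (i < k)%N ->
      (s'.1 (1 + k * k + i)%N != 0%N) = (0 < s.2 (k + k + 2 + i)%N)) s.
Proof.
move=> b0 hk hO hfree; case: s => N M /= [h1 hF hN] hrow.
(* The frame clause of [setup] is given up, as the output cells lie outside the register bank; the
   cells still read are listed one by one. *)
pose I (i : nat) (s : memory R) := [/\ [/\ s.1 0%N = k, s.1 b = 1%N,
  s.1 (b + 1)%N = (k + k + 2)%N, s.1 (b + 2)%N = i &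
  s.1 (b + 4)%N = (1 + k * k)%N], s.2 1%N = 0,
  forall j, s.2 (k + k + 2 + j)%N = M (k + k + 2 + j)%N &
  forall j, (j < k)%N -> s.1 (1 + k * k + j)%N =
    (if (j < i)%N then nat_of_bool (0 < M (k + k + 2 + j)%N)%R else 0%N)].
apply: (@wp_le _ _ (2 + ((k - 0) * 9).+1)%N _ (I (maxn 0 k))); last 2 first.
- by lia.
- move=> s' [_ _ _ h] i ik; rewrite h// max0n ik; by case: (0 < _).
do 2 apply: wp_opS => //; rewrite /exec_instr/=.
apply: (@wp_for _ I _ _ _ k); first by move=> i s' [[]].
  move=> i {h1 hF hrow hN N} [N M'] hi [/= [h0 h1 hF hi' hrow] hM1 hM hout].
  do 3 apply: wp_opS => //; rewrite /exec_instr/=; upds.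
  have hMi : M' (N (b + 1) + N (b + 2))%N = M (k + k + 2 + i)%N.
    by rewrite hF hi' hM.
  rewrite hMi; apply: (@wp_seq _ _ _ 3 1).
  have fri := hfree i hi.
  apply: wp_ifR => /=; upds; rewrite hM1 => hle.
    apply: wp_skip; apply: wp_op => //; rewrite /exec_instr/=; split=> /=.
    - by split; upds => //; lia.
    - by upds.
    - by move=> j; upds; rewrite hM.
    - have hz : (0 < M (k + k + 2 + i)%N) = false by apply/negbTE; rewrite -leNgt.
      move=> j jk; have frj := hfree j jk; upds; rewrite hout//.
      have [->|ji] := eqVneq j i; first by rewrite hz; do 2 case: ifP.
      by rewrite [in RHS]ltnS [in RHS]leq_eqVlt (negPf ji).
  apply: wp_op => //; rewrite /exec_instr/=; upds; rewrite hrow hi'.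
  apply: wp_op => //; rewrite /exec_instr/=; split=> /=.
  - by split; upds => //; lia.
  - by upds.
  - by move=> j; upds; rewrite hM.
  - move=> j jk; have frj := hfree j jk; upds; rewrite ltnS leq_eqVlt.
    have [->|ji] := eqVneq j i; first by upds; rewrite hle.
    by upds; rewrite hout.
split=> /=.
- by split; upds => //; rewrite hN ?b0.
- by upds.
- by move=> j; upds.
- by move=> j jk; have frj := hfree j jk; upds; rewrite hN// hO.
Qed.

Lemma wp_local_ratio (R : realType) b k N0 (M0 : nat -> R) (e : rel 'I_k) gam :
  (0 < b)%N -> N0 0%N = k -> simple_graph e ->
  (forall u v : 'I_k, (v < u)%N -> N0 (1 + u * k + v)%N = e u v) ->
  (forall u v, (v < u < k)%N ->
    (1 + u * k + v < b)%N || (b + 8 <= 1 + u * k + v)%N) ->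
  (forall i, (i < k)%N -> N0 (1 + k * k + i)%N = 0%N) ->
  (forall i, (i < k)%N ->
    (1 + k * k + i < b)%N || (b + 8 <= 1 + k * k + i)%N) ->
  (forall i : 'I_k, M0 i = gam i false /\ M0 (k + i)%N = gam i true) ->
  (forall i b, 0 <= gam i b) ->
  wp (local_ratio b) (50 * k.+1 ^ 2)%N (fun s' : memory R =>
    let st := [ffun i : 'I_k => s'.1 (1 + k * k + i)%N != 0%N] in
    independent e st /\
    forall s : state k, independent e s -> g gam st <= 2 * g gam s) (N0, M0).
Proof.
move=> b0 hk [esym eirr] hadj hfree hO hfreeO hM0 hgam.
have hT : (12 * k + 20 + (11 * k + 10 + (3 + k * (k * 17 + 6) + (3 + k * 9)))
    <= 50 * k.+1 ^ 2)%N.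
  by rewrite expnS expn1; nia.
apply: (wp_le _ hT (fun s h => h)); apply: wp_seq.
apply: (wp_le (wp_copy_input _ b0 hk)) => // s1 [hs1 hM1]; apply: wp_seq.
apply: (wp_le (wp_compute_weights b0 hk hs1 hM1)) => // s2 [hs2 hM2].
apply: wp_seq.
have hw (i : 'I_k) : weight M0 k i = Num.max (gam i false - gam i true) 0.
  by have [h1 h2] := hM0 i; rewrite /weight h1 h2.
apply: (wp_le (wp_pay_edges (w := fun i => Num.max (gam i false - gam i true) 0)
  b0 hk eirr hadj hfree hs2 _ _)) => //.
- by move=> i; rewrite le_max lexx orbT.
- by move=> i; rewrite hM2.
move=> s3 [hs3 hrow hL].
apply: (wp_le (wp_write_output b0 hk hO hfreeO hs3 hrow)) => // s4 hout.
apply: (local_ratio_approx hgam (r := fun i : 'I_k => s3.2 (k + k + 2 + i)%N)).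
(* Symmetry extends the lower triangle to all edges, and irreflexivity excludes the diagonal. *)
- have [h1 h2 h3] := hL; split=> // u v _ euv.
  have [uv|vu|uv] := ltngtP u v.
  + by have [] : _ \/ _ := h3 v u uv _; rewrite -?(esym u)//; [right|left].
  + exact: h3.
  + by move: euv; rewrite (val_inj uv) eirr.
- by move=> i; rewrite ffunE hout.
Qed.

(* No constant address is free for all [k]. For [k >= 8] the first row of the
   adjacency matrix is redundant by symmetry, so nat cells 1 to 8 are free; for
   [k < 8] the cells from 100 on are unused. Cell 1 holds [e 0 0 = 0]. *)
Definition local_ratio_program : seq instr :=
  compile 0 (Op (NSet 1 8) ;; IfN 1 0 (local_ratio 1) (local_ratio 100)).

Lemma local_ratio_program_correct (R : realType) k (e : rel 'I_k)
    (gam : 'I_k -> bool -> R) :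
  simple_graph e -> (forall i b, 0 <= gam i b) ->
  exists c : config R,
    ram_exec local_ratio_program (60 * k.+1 ^ 2) (ram_input e gam) = Some c /\
    independent e (ram_output k c) /\
    forall s : state k, independent e s ->
      g gam (ram_output k c) <= 2 * g gam s.
Proof.
move=> he hgam.
pose N := nmem (ram_input e gam); pose M := rmem (ram_input e gam).
have hN u v (uk : (u < k)%N) (vk : (v < k)%N) :
    N (1 + u * k + v)%N = e (Ordinal uk) (Ordinal vk).
  rewrite -addnA add1n /N/= ifT; last by nia.
  have k0 : (0 < k)%N by lia.
  rewrite divnMDl// divn_small// addn0 modnMDl modn_small//.
  by rewrite !insubT.
have hN0 : N 0%N = k by [].
have hout i : (i < k)%N -> N (1 + k * k + i)%N = 0%N.
  by move=> ik; rewrite /N /= ifF//; lia.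
have hM (i : 'I_k) : M i = gam i false /\ M (k + i)%N = gam i true.
  rewrite /M/=; split; first by rewrite insubT//= => hi; congr gam; exact: val_inj.
  rewrite insubF; last by lia.
  by rewrite addKn insubT//= => hi; rewrite leq_addr; congr gam; exact: val_inj.
have [c [hc hq]] : exists c : config R,
    ram_exec local_ratio_program (60 * k.+1 ^ 2) (Config 0 N M) = Some c /\
    let st := [ffun i : 'I_k => nmem c (1 + k * k + i)%N != 0%N] in
    independent e st /\
    forall s : state k, independent e s -> g gam st <= 2 * g gam s.
  apply: (@wp_exec _ _ _ (fun s : memory R =>
    let st := [ffun i : 'I_k => s.1 (1 + k * k + i)%N != 0%N] in
    independent e st /\
    forall s : state k, independent e s -> g gam st <= 2 * g gam s) (N, M)).
  have hT : ((50 * k.+1 ^ 2).+3 <= 60 * k.+1 ^ 2)%N.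
    by rewrite expnS expn1; nia.
  apply: (wp_le _ hT (fun s h => h)); apply: wp_opS => //.
  rewrite /exec_instr/=.
  (* Cell 1 is neither a lower-triangle entry nor an output cell, so it can hold the threshold 8. *)
  have hN1 u v : (v < u < k)%N -> (1 + u * k + v != 1)%N by nia.
  have hO1 i : (i < k)%N -> (1 + k * k + i != 1)%N by nia.
  apply: wp_ifN => /=; rewrite upd_same upd_other// hN0 => h8;
    apply: wp_local_ratio => //.
  - move=> u v vu; rewrite upd_other ?hN1 ?vu ?ltn_ord// hN.
    by congr (nat_of_bool (e _ _)); exact: val_inj.
  - by move=> u v ?; nia.
  - by move=> i ik; rewrite upd_other ?hO1 ?hout.
  - by move=> i ?; nia.
  - move=> u v vu; rewrite upd_other ?hN1 ?vu ?ltn_ord// hN.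
    by congr (nat_of_bool (e _ _)); exact: val_inj.
  - by move=> u v ?; nia.
  - by move=> i ik; rewrite upd_other ?hO1 ?hout.
  - by move=> i ?; nia.
by exists c; split.
Qed.

Theorem theorem6 (R : realType) :
  (* (i) learning the parameter vector *)
  (exists C : R, 0 < C /\
   forall (k : nat) (e : rel 'I_k), simple_graph e ->
   forall B eps delta : R, 0 <= B -> 0 < eps -> 0 < delta < 1 ->
   exists (T : nat) (pol : seq ('I_k -> R) -> option 'I_k)
          (est : seq ('I_k -> R) -> 'I_k -> bool -> R) (L : seq (state k)),
     T%:R <= C * (B ^+ 2 * k%:R / eps ^+ 2) * (1 + ln (k%:R / delta)) /\
     (size L <= k.+1)%N /\
     forall gam : 'I_k -> bool -> R, (forall i b, 0 <= gam i b) ->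
     forall D : 'I_k -> state k -> probability R R,
       (forall i s, D i s `[0, B]%classic = 1%E) ->
       (forall i s, (\int[D i s]_x x%:E = (mu gam s i)%:E)%E) ->
     forall (d : measure_display) (Omega : measurableType d)
            (P : probability Omega R)
            (Y : 'I_T * 'I_k * state k -> {RV P >-> R}),
       mutually_independent Y ->
       (forall t i s A, measurable A ->
          distribution P (Y (t, i, s)) A = D i s A) ->
       let good := [set w : Omega | forall i b,
             `| est (run e pol (observations Y w) T).2 i b - gam i b | <= eps] in
       measurable good /\
       ((1 - delta)%:E <= P good)%E /\
       (forall (w : Omega) (t : nat), (t < T)%N ->
          (run e pol (observations Y w) t).1 \in L))
  /\
  (* (ii) polynomial-time 2-approximation of min_{s in S} g(s) *)
  (exists (prog : seq instr) (C dg : nat),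
   forall (k : nat) (e : rel 'I_k), simple_graph e ->
   forall gam : 'I_k -> bool -> R, (forall i b, 0 <= gam i b) ->
   exists c : config R,
     ram_exec prog (C * k.+1 ^ dg) (ram_input e gam) = Some c /\
     independent e (ram_output k c) /\
     forall s : state k, independent e s ->
       g gam (ram_output k c) <= 2 * g gam s).
Proof.
split.
  exists 50; split=> // k e _ B eps delta B0 eps0 hd.
  exact: parameter_learning.
exists local_ratio_program, 60%N, 2%N => k e he gam hgam.
exact: local_ratio_program_correct.
Qed.
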